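(* Let $\pi$ be a probability measure on a measurable space $\mathsf{X}$, let $\{q(x,\cdot)\}_{x\in\mathsf{X}}$ be a Markov kernel of proposal distributions, and for each $x\in\mathsf{X}$ let $Q_{x}$ be a probability measure on $\mathbb{R}_{+}$ with $\int wQ_{x}(\mathrm{d}w)=1$; set $\tilde{\pi}_{x}(\mathrm{d}w):=wQ_{x}(\mathrm{d}w)$ and $\tilde{\pi}(\mathrm{d}x,\mathrm{d}w):=\pi(\mathrm{d}x)\tilde{\pi}_{x}(\mathrm{d}w)$ on $\mathsf{E}:=\mathsf{X}\times\mathbb{R}_{+}$. Let $\mathfrak{r}(x,y):=\frac{\pi(\mathrm{d}y)q(y,\mathrm{d}x)}{\pi(\mathrm{d}x)q(x,\mathrm{d}y)}$ and $a(x,y):=1\wedge\mathfrak{r}(x,y)$. Define the pseudo-marginal kernel \[ \tilde{P}(x,w;\mathrm{d}y,\mathrm{d}u):=\Big[1\wedge\Big\{\mathfrak{r}(x,y)\frac{u}{w}\Big\}\Big]q(x,\mathrm{d}y)Q_{y}(\mathrm{d}u)+\delta_{(x,w)}(\mathrm{d}y,\mathrm{d}u)\tilde{\rho}(x,w), \] and the embedded marginal kernel \[ \bar{P}(x,w;\mathrm{d}y,\mathrm{d}u):=a(x,y)q(x,\mathrm{d}y)\tilde{\pi}_{y}(\mathrm{d}u)+\delta_{(x,w)}(\mathrm{d}y,\mathrm{d}u)\rho(x), \] where $\tilde{\rho}(x,w)$ and $\rho(x)=1-\int a(x,y)q(x,\mathrm{d}y)$ are the rejection probabilities making these Markov kernels.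 Then for any $p\in(1,\infty]$, $q\ge1$ with $p^{-1}+q^{-1}=1$, any $s>0$ and any $f\in\mathrm{L}_{0}^{2p}(\tilde{\pi})$, \[ \mathcal{E}(\bar{P},f)\le s\,\mathcal{E}(\tilde{P},f)+\Phi_{p}(f)\Big(\int_{\mathsf{X}}\tilde{\pi}_{x}(w\ge s)\,\pi(\mathrm{d}x)\Big)^{1/q}, \] where $\Phi_{p}(f):=4\|f\|_{2p}^{2}$ for $p\in(1,\infty)$ and $\Phi_{\infty}(f):=\|f\|_{\mathrm{osc}}^{2}$.
   Context: All norms, $\mathrm{L}^{r}$ spaces and Dirichlet forms are with respect to $\tilde{\pi}$: $\|f\|_{r}=(\int|f|^{r}\mathrm{d}\tilde{\pi})^{1/r}$, $\mathrm{L}_{0}^{r}(\tilde{\pi})$ consists of $f$ with finite $r$-norm and $\tilde{\pi}(f)=0$, $\|f\|_{\mathrm{osc}}$ is the $\tilde{\pi}$-essential supremum minus essential infimum, and $\mathcal{E}(T,f)=\langle(\mathrm{Id}-T)f,f\rangle_{\mathrm{L}^{2}(\tilde{\pi})}$. $\mathfrak{r}$ is the Radon–Nikodym derivative of $\pi(\mathrm{d}y)q(y,\mathrm{d}x)$ with respect to $\pi(\mathrm{d}x)q(x,\mathrm{d}y)$ (Metropolis–Hastings ratio). Both $\tilde{P}$ and $\bar{P}$ are $\tilde{\pi}$-invariant. *)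

(* Defs.v *)
From HB Require Import structures.
From mathcomp Require Import all_boot all_order all_algebra.
From mathcomp Require Import all_classical all_reals all_analysis.
Set Implicit Arguments. Unset Strict Implicit. Unset Printing Implicit Defensive.
Import Order.TTheory GRing.Theory Num.Theory.
Import numFieldNormedType.Exports.
Local Open Scope classical_set_scope.
Local Open Scope ring_scope.
Local Open Scope ereal_scope.

Section PM.
Context {d : measure_display} {X : measurableType d} {R : realType}.

(* integral w.r.t. pi~(dx,dw) = pi(dx) w Q_x(dw) on E = X x R_+ *)
Definition pit_int (pi : probability X R) (Q : R.-pker X ~> R)
  (g : X * R -> \bar R) : \bar R :=
  \int[pi]_x \int[Q x]_w (w%:E * g (x, w)).

Definition pit_set pi Q (A : set (X * R)) : \bar R :=
  pit_int pi Q (fun z => (\1_A z)%:E).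

Definition alpha_pm (r : X -> X -> R) (x : X) (w : R) (y : X) (u : R) : R :=
  Num.min 1%R (r x y * u / w)%R.

Definition Ptilde_op (q : R.-pker X ~> X) (Q : R.-pker X ~> R)
  (r : X -> X -> R) (f : X * R -> R) (z : X * R) : \bar R :=
  \int[q z.1]_y \int[Q y]_u ((alpha_pm r z.1 z.2 y u)%:E * (f (y, u))%:E)
  + (1 - \int[q z.1]_y \int[Q y]_u (alpha_pm r z.1 z.2 y u)%:E) * (f z)%:E.

(* (P- f)(x,w) : embedded marginal kernel applied to f,
   pi~_y(du) = u Q_y(du), a(x,y) = 1 /\ r(x,y) *)
Definition Pbar_op (q : R.-pker X ~> X) (Q : R.-pker X ~> R)
  (r : X -> X -> R) (f : X * R -> R) (z : X * R) : \bar R :=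
  \int[q z.1]_y \int[Q y]_u ((Num.min 1%R (r z.1 y))%:E * (u%:E * (f (y, u))%:E))
  + (1 - \int[q z.1]_y (Num.min 1%R (r z.1 y))%:E) * (f z)%:E.

Definition dirichlet pi Q (Tf : X * R -> \bar R) (f : X * R -> R) : \bar R :=
  pit_int pi Q (fun z => (f z)%:E * ((f z)%:E - Tf z)).

Definition pit_esssup pi Q (f : X * R -> R) : \bar R :=
  ereal_inf [set M : \bar R | pit_set pi Q [set z | M < (f z)%:E] = 0].
Definition pit_essinf pi Q (f : X * R -> R) : \bar R :=
  - pit_esssup pi Q (fun z => - f z)%R.
Definition pit_osc pi Q (f : X * R -> R) : R :=
  fine (pit_esssup pi Q f - pit_essinf pi Q f).

Definition in_L0_2p pi Q (p : \bar R) (f : X * R -> R) : Prop :=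
  [/\ measurable_fun setT f,
      pit_int pi Q (fun z => (f z)%:E) = 0 &
      match p with
      | EFin p' => pit_int pi Q (fun z => (`|f z| `^ (2 * p'))%:E) < +oo
      | EPInf => exists M : R, pit_set pi Q [set z | M < `|f z|]%R = 0
      | ENInf => False
      end].

Definition Phi pi Q (p : \bar R) (f : X * R -> R) : R :=
  match p with
  | EFin p' => 4 * (fine (pit_int pi Q (fun z => (`|f z| `^ (2 * p'))%:E))) `^ (p'^-1)
  | EPInf => pit_osc pi Q f ^+ 2
  | ENInf => 0
  end%R.

Definition conj_exp (p : \bar R) (q : R) : Prop :=
  match p with
  | EFin p' => (p'^-1 + q^-1 = 1)%R
  | EPInf => q = 1%R
  | ENInf => False
  end.

Definition tail_mass (pi : probability X R) (Q : R.-pker X ~> R) (s : R) : R :=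
  fine (\int[pi]_x \int[Q x]_w (w * \1_[set v : R | s <= v]%R w)%:E).

End PM.

(* Main.v *)
Require Import Defs.
From HB Require Import structures.
From mathcomp Require Import all_boot all_order all_algebra.
From mathcomp Require Import all_classical all_reals all_analysis.
From mathcomp Require Import measurable_realfun ring lra.
Set Implicit Arguments. Unset Strict Implicit. Unset Printing Implicit Defensive.
Import Order.TTheory GRing.Theory Num.Theory.
Import numFieldNormedType.Exports.
Local Open Scope classical_set_scope.
Local Open Scope ring_scope.
Local Open Scope ereal_scope.

(** Write [z = (x, w)], [z' = (y, u)] and let [M] be the measure
    [pi(dx) Q_x(dw) q(x, dy) Q_y(du)] on pairs [(z, z')].  Both kernels move
    from [z] to [z'] with a density [c (z, z')] with respect to
    [q(x, dy) Q_y(du)], namely [(1 /\ r) u] for the embedded marginal kernel and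
    [1 /\ (r u / w)] for the pseudo-marginal one.  Since
    [r(x, y) r(y, x) = 1] almost everywhere, the edge weight [k = w c] is
    symmetric under the exchange of [z] and [z'], so both Dirichlet forms are
    [1/2 \int k(z, z') (f z - f z')^2 dM].

    Where [w] and [u] are below [s], [w u (1 /\ r) <= s (w /\ (r u))], so the
    embedded marginal weight is at most [s] times the pseudo-marginal one.  By
    symmetry the rest costs at most
    [\int 1_(w >= s) w u (1 /\ r) (f z - f z')^2 dM], which is bounded by
    Hoelder's inequality, or by the oscillation of [f] when [p = +oo]. *)

(** * Joint kernels *)

(** Three points shape the proof. The Dirichlet forms integrate signed functions, whereas the
    exchange symmetry is established for nonnegative ones; so [f] is first shown to be square
    integrable, and signed Fubini is applied only to integrands dominated by squares of [f]. The
    operators are formulas evaluated at every point, including points with w <= 0 and points where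
    [f] is not integrable under the proposal; the identities for them are therefore
    almost-everywhere identities, multiplied by w. Finally, c(z, .) has mass at most 1 for every z,
    so by symmetry both marginals of k dM are dominated by pi~. This one fact yields integrability,
    carries null sets from points to pairs, and bounds both Hoelder factors. The constant 4 comes
    from (a - b)^2 <= 4 (a^2 / 2 + b^2 / 2), raised to the power p by convexity. The factor 1/2 of
    the forms is absorbed because the tail is counted once at each end of a move. *)

Section precomposed_kernel.
Context {dA dB dC : measure_display} {A : measurableType dA}
  {B : measurableType dB} {C : measurableType dC} {R : realType}.
Variables (k : R.-fker B ~> C) (g : A -> B).
Hypothesis mg : measurable_fun setT g.

(** The measurability proof is an argument so that the kernel structures declared on [kpre mg] can
    recover it by unification. *)
Definition kpre (_ : measurable_fun setT g) : A -> {measure set C -> \bar R} :=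
  fun a => k (g a).

Let measurable_kpre U : measurable U -> measurable_fun setT (kpre mg ^~ U).
Proof.
by move=> mU; exact: (measurableT_comp (measurable_kernel k U mU) mg).
Qed.

HB.instance Definition _ := isKernel.Build _ _ _ _ _ (kpre mg) measurable_kpre.

Let kpre_uub : measure_fam_uub (kpre mg).
Proof. by have [b kb] := measure_uub k; exists b => a; exact: kb. Qed.

HB.instance Definition _ := Kernel_isFinite.Build _ _ _ _ _ (kpre mg) kpre_uub.

End precomposed_kernel.

Section constant_kernel.
Context {dA dB : measure_display} {A : measurableType dA}
  {B : measurableType dB} {R : realType}.
Variable mu : probability B R.

(** Makes a probability the first stage of a [kjoint], with source [unit]. *)
Definition kcst : A -> {measure set B -> \bar R} := fun=> mu.

Let measurable_kcst U : measurable U -> measurable_fun setT (kcst ^~ U).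
Proof. by move=> mU; exact: measurable_cst. Qed.

HB.instance Definition _ := isKernel.Build _ _ _ _ _ kcst measurable_kcst.

Let kcst_uub : measure_fam_uub kcst.
(* The uniform bound must be strict, so total mass 1 calls for a constant above 1. *)
Proof. exists 2%R => a.
by rewrite [ltLHS](_ : _ = 1) ?lte1n//; exact: (probability_setT mu). Qed.

HB.instance Definition _ := Kernel_isFinite.Build _ _ _ _ _ kcst kcst_uub.

End constant_kernel.

Section joint_kernel.
Context {dA dB dC : measure_display} {A : measurableType dA}
  {B : measurableType dB} {C : measurableType dC} {R : realType}.
Variables (l : R.-fker A ~> B) (k : R.-fker B ~> C).

(** The kernel remembers its starting point, so that kernel composition produces a joint law and not
    only the law of the last coordinate. *)
Definition kpair : B -> {measure set (B * C) -> \bar R} :=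
  fun b => measure_function_pushforward__canonical__measure_function_Measure
    (k b) (@pair1_measurable _ _ B C b).

Let measurable_kpair U : measurable U -> measurable_fun setT (kpair ^~ U).
Proof.
move=> mU.
rewrite [X in measurable_fun _ X](_ : _ =
  fun b => \int[k b]_c (\1_U (b, c))%:E).
  apply: (measurable_fun_integral_finite_kernel (fun z => (\1_U z)%:E)).
    by move=> z; rewrite lee_fin.
  by apply/measurable_EFinP; exact: measurable_indic.
apply/funext => b; rewrite integral_indic// ?setIT//.
by rewrite -[X in measurable X]setTI; exact: (@pair1_measurable _ _ B C).
Qed.

HB.instance Definition _ := isKernel.Build _ _ _ _ _ kpair measurable_kpair.

Let kpair_uub : measure_fam_uub kpair.
Proof. by have [b kb] := measure_uub k; exists b => a; exact: kb. Qed.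

HB.instance Definition _ := Kernel_isFinite.Build _ _ _ _ _ kpair kpair_uub.

Let kpair_snd : R.-fker (A * B)%type ~> (B * C)%type :=
  kpre kpair (@measurable_snd _ _ A B).

(* The finite-kernel instance of [mkcomp] is only visible inside this module. *)
Import KCOMP_FINITE_KERNEL.

Definition kjoint : R.-fker A ~> (B * C)%type := mkcomp l kpair_snd.

Lemma ge0_integral_kjoint a f : (forall z, 0 <= f z) -> measurable_fun setT f ->
  \int[kjoint a]_z f z = \int[l a]_b \int[k b]_c f (b, c).
Proof.
move=> f0 mf; rewrite /kjoint integral_kcomp//.
apply: eq_integral => b _; rewrite /kpre /= /kpair.
by rewrite ge0_integral_pushforward.
Qed.

End joint_kernel.

Section fubini_joint_kernel.
Context {dA dB dC : measure_display} {A : measurableType dA}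
  {B : measurableType dB} {C : measurableType dC} {R : realType}.
Variables (l : R.-fker A ~> B) (k : R.-fker B ~> C).
Implicit Type f : B * C -> \bar R.

(** Subtraction of extended reals is total and measurable, so splitting into positive and negative
    parts works even where the integral reads oo - oo. This makes the operators measurable
    everywhere. *)
Lemma measurable_integral_kernel f : measurable_fun setT f ->
  measurable_fun setT (fun b => \int[k b]_c f (b, c)).
Proof.
move=> mf; under eq_fun do rewrite integralE.
apply: emeasurable_funB.
- rewrite [X in measurable_fun _ X](_ : _ =
    fun b => \int[k b]_c f^\+ (b, c)).
    apply: (measurable_fun_integral_finite_kernel f^\+) => //.
    exact: measurable_funepos.
  by apply/funext => b; apply: eq_integral => c _; rewrite !funeposE.
- rewrite [X in measurable_fun _ X](_ : _ =
    fun b => \int[k b]_c f^\- (b, c)).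
    apply: (measurable_fun_integral_finite_kernel f^\-) => //.
    exact: measurable_funeneg.
  by apply/funext => b; apply: eq_integral => c _; rewrite !funenegE.
Qed.

Lemma integrable_integral_kernel a f : (forall z, 0 <= f z) ->
  (kjoint l k a).-integrable setT f ->
  (l a).-integrable setT (fun b => \int[k b]_c f (b, c)).
Proof.
move=> f0 /integrableP[mf]; under eq_integral do rewrite gee0_abs//.
rewrite ge0_integral_kjoint// => foo; apply/integrableP; split.
  exact: measurable_integral_kernel.
by under eq_integral do rewrite gee0_abs ?integral_ge0//.
Qed.

Lemma integral_kjoint a f : (kjoint l k a).-integrable setT f ->
  \int[kjoint l k a]_z f z = \int[l a]_b \int[k b]_c f (b, c).
Proof.
move=> fi; have mf := measurable_int _ fi.
rewrite integralE ge0_integral_kjoint//; last exact: measurable_funepos.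
rewrite ge0_integral_kjoint//; last exact: measurable_funeneg.
rewrite -integralB//.
- apply: eq_integral => b _; rewrite /= [RHS]integralE.
  by congr (_ - _); apply: eq_integral => c _; rewrite ?funeposE ?funenegE.
- by apply: integrable_integral_kernel => //; exact: integrable_funepos.
- by apply: integrable_integral_kernel => //; exact: integrable_funeneg.
Qed.

(** The section integrals of [|f|] form an integrable function, hence are finite almost
    everywhere. *)
Lemma integrable_kjoint_ae a f : (kjoint l k a).-integrable setT f ->
  {ae l a, forall b, (k b).-integrable setT (fun c => f (b, c))}.
Proof.
move=> fi; have mf := measurable_int _ fi.
have /integrable_ae : (l a).-integrable setT (fun b => \int[k b]_c `|f (b, c)|).
  apply: (@integrable_integral_kernel _ (abse \o f)).
    by move=> z; exact: abse_ge0.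
  exact: integrable_abse.
move=> /(_ measurableT); apply: filterS => b /(_ Logic.I) fb.
apply/integrableP; split; first exact: measurable_fun_pair2.
by move: fb; rewrite fin_numE => /andP[_]; rewrite ltey.
Qed.

End fubini_joint_kernel.

(** * Integration against a density *)

Section ge0_integral_density.
Context {d : measure_display} {T : measurableType d} {R : realType}.
Variables (mu nu : {measure set T -> \bar R}) (r : T -> R).
Hypotheses (mr : measurable_fun setT r) (r0 : forall x, (0 <= r x)%R).
Hypothesis munu : forall C, measurable C ->
  \int[mu]_x ((r x)%:E * (\1_C x)%:E) = nu C.

Import HBNNSimple.

Let density_nnsfun (h : {nnsfun T >-> R}) :
  \int[mu]_x ((r x)%:E * (h x)%:E) = \int[nu]_x (h x)%:E.
Proof.
have mi y : measurable_fun setT (fun x => (\1_(h @^-1` [set y]) x : R)).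
  exact: measurable_indic.
transitivity (\int[mu]_x (\sum_(y \in range h)
    ((r x)%:E * (y * \1_(h @^-1` [set y]) x)%:E))).
  apply: eq_integral => x _; rewrite [in LHS]fimfunE -fsumEFin//.
  by rewrite ge0_mule_fsumr// => y; rewrite EFinM nnfun_muleindic_ge0.
under [RHS]eq_integral do rewrite fimfunE -fsumEFin//.
rewrite !ge0_integral_fsum//=; last 4 first.
- move=> y; apply/measurable_EFinP; exact: measurable_funM.
- by move=> y x _; rewrite EFinM nnfun_muleindic_ge0.
- move=> y; apply/measurable_EFinP.
  by apply: measurable_funM => //; exact: measurable_funM.
- move=> y x _; apply: mule_ge0; first by rewrite lee_fin.
  by rewrite EFinM nnfun_muleindic_ge0.
apply: eq_fsbigr => y _.
(* A negative [y] has an empty level set under [h], so both sides vanish. *)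
have [y0|y0] := leP 0%R y; last first.
  rewrite !integral0_eq// => x _; rewrite preimage_nnfun0// indic0 mulr0//.
  by rewrite mule0.
under eq_integral do rewrite EFinM muleCA.
under [RHS]eq_integral do rewrite EFinM.
rewrite !ge0_integralZl//; first last.
- exact/measurable_EFinP.
- by move=> x _; rewrite mule_ge0 ?lee_fin.
- by apply: emeasurable_funM; exact/measurable_EFinP.
- by rewrite munu// integral_indic// setIT.
Qed.

(** The density is known on indicators only; linearity extends it to simple functions, and monotone
    convergence on both sides to nonnegative ones. *)
Lemma ge0_integral_density (h : T -> \bar R) :
  measurable_fun setT h -> (forall x, 0 <= h x) ->
  \int[mu]_x ((r x)%:E * h x) = \int[nu]_x h x.
Proof.
move=> mh h0; pose h_ := nnsfun_approx measurableT mh.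
transitivity (\int[mu]_x (lim ((r x)%:E * (h_ n x)%:E @[n --> \oo]))).
  apply/eq_integral => x _; apply/esym/cvg_lim => //.
  by apply: cvgeZl => //; exact: cvg_nnsfun_approx.
rewrite monotone_convergence//; first last.
- move=> x _ a b ab; rewrite lee_wpmul2l ?lee_fin//.
  exact/lefP/nd_nnsfun_approx.
- by move=> n x _; rewrite mule_ge0 ?lee_fin.
- by move=> n; apply: emeasurable_funM; exact/measurable_EFinP.
under eq_fun do rewrite density_nnsfun.
rewrite -monotone_convergence//; first last.
- by move=> x _ a b ab; rewrite lee_fin; exact/lefP/nd_nnsfun_approx.
- by move=> n x _; rewrite lee_fin.
- by move=> n; exact/measurable_EFinP.
apply: eq_integral => x _; apply/cvg_lim => //.
exact: cvg_nnsfun_approx.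
Qed.

End ge0_integral_density.

(** * Reversibility of the proposal pair *)

Lemma fker_tonelli {dA dB dC dD : measure_display} {A : measurableType dA}
    {B : measurableType dB} {C : measurableType dC} {D : measurableType dD}
    {R : realType} (l : R.-fker A ~> B) (k : R.-fker C ~> D) a c
    (f : B * D -> \bar R) :
  measurable_fun setT f -> (forall z, 0 <= f z) ->
  \int[l a]_b \int[k c]_d f (b, d) = \int[k c]_d \int[l a]_b f (b, d).
Proof.
move=> mf f0.
(* The values of a finite kernel are s-finite; copies carrying that structure are packed so that
   Tonelli's theorem applies to them. *)
pose Hl := isSFinite.Build _ _ _ _ (sfinite_kernel_measure l a).
pose Hk := isSFinite.Build _ _ _ _ (sfinite_kernel_measure k c).
pose la := HB.pack_for (SFiniteMeasure.type B R) (Measure.sort (l a)) Hl.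
pose kc := HB.pack_for (SFiniteMeasure.type D R) (Measure.sort (k c)) Hk.
have lE : l a = la by exact: eq_measure.
have kE : k c = kc by exact: eq_measure.
by rewrite lE kE; exact: sfinite_Fubini.
Qed.

Ltac mtuple := repeat first
  [ exact: measurable_id | exact: measurable_fst | exact: measurable_snd
  | exact: measurable_cst | assumption
  | apply: measurable_fun_pair
  | apply: (measurableT_comp measurable_fst)
  | apply: (measurableT_comp measurable_snd) ].

Section reversible_pair.
Context {d : measure_display} {X : measurableType d} {R : realType}.
Variables (pi : probability X R) (q : R.-pker X ~> X) (Q : R.-pker X ~> R).

(** This is pi(dx) Q_x(dw) without the factor w, so pi~ is [hatk] with density w. Below, [movek] is
    the measure [M] of the overview and [basek] its image on the positions (x, y). *)
Definition hatk : R.-fker unit ~> (X * R)%type := kjoint (kcst pi) Q.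
Definition propk : R.-fker X ~> (X * R)%type := kjoint q Q.
Definition propzk : R.-fker (X * R)%type ~> (X * R)%type :=
  kpre propk (@measurable_fst _ _ X R).
Definition movek : R.-fker unit ~> ((X * R) * (X * R))%type :=
  kjoint hatk propzk.
Definition basek : R.-fker unit ~> (X * X)%type := kjoint (kcst pi) q.

Implicit Type G : (X * R) * (X * R) -> \bar R.

Definition section_int G (xy : X * X) : \bar R :=
  \int[Q xy.1]_w \int[Q xy.2]_u G ((xy.1, w), (xy.2, u)).

Lemma measurable_section_int G : measurable_fun setT G ->
  measurable_fun setT (section_int G).
Proof.
move=> mG.
have m1 : measurable_fun setT (fun t : (X * X) * R => t.1.2) by mtuple.
have mG' : measurable_fun setT (fun t : ((X * X) * R) * R =>
   G ((t.1.1.1, t.1.2), (t.1.1.2, t.2))).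
  by apply: measurableT_comp => //; mtuple.
have := measurable_integral_kernel (kpre Q m1) mG'.
have m2 : measurable_fun setT (fun t : X * X => t.1) by mtuple.
by move=> /(measurable_integral_kernel (kpre Q m2)).
Qed.

(** Given the positions the two weights are independent, so they can be integrated last.
    Reversibility then only has to be treated on positions, the only variables that [r] sees. *)
Lemma ge0_integral_movek G : measurable_fun setT G -> (forall z, 0 <= G z) ->
  \int[movek tt]_z G z = \int[basek tt]_xy section_int G xy.
Proof.
move=> mG G0.
rewrite /movek ge0_integral_kjoint// /hatk ge0_integral_kjoint//; first last.
- exact: measurable_integral_kernel.
- by move=> z; exact: integral_ge0.
rewrite /basek ge0_integral_kjoint//; first last.
- exact: measurable_section_int.
- by move=> z; apply: integral_ge0 => ? _; exact: integral_ge0.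
apply: eq_integral => x _.
have mGx : measurable_fun setT (fun t : (R * X) * R =>
   G ((x, t.1.1), (t.1.2, t.2))).
  by apply: measurableT_comp => //; mtuple.
transitivity (\int[Q x]_w \int[q x]_y \int[Q y]_u G ((x, w), (y, u))).
  apply: eq_integral => w _; rewrite /propzk /propk /kpre /= ge0_integral_kjoint//.
  by apply: measurableT_comp => //; mtuple.
rewrite (@fker_tonelli _ _ _ _ _ _ _ _ _ Q q x x
  (fun wy => \int[Q wy.2]_u G ((x, wy.1), (wy.2, u))))//.
- have m2 : measurable_fun setT (fun t : R * X => t.2) by mtuple.
  exact: (measurable_integral_kernel (kpre Q m2) mGx).
- by move=> z; exact: integral_ge0.
Qed.

Variable r : X -> X -> R.
Hypothesis mr : measurable_fun setT (fun xy : X * X => r xy.1 xy.2).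
Hypothesis r0 : forall x y, (0 <= r x y)%R.
Hypothesis r_RN : forall C : set (X * X), measurable C ->
     \int[pi]_x \int[q x]_y ((r x y)%:E * (\1_C (x, y))%:E)
     = \int[pi]_x \int[q x]_y (\1_C (y, x))%:E.

(** The image of [basek] under exchange of positions has density [r]; [r_RN] is this fact on
    indicators. *)
Lemma ge0_integral_basek_swap (h : X * X -> \bar R) :
  measurable_fun setT h -> (forall z, 0 <= h z) ->
  \int[basek tt]_z ((r z.1 z.2)%:E * h z) = \int[basek tt]_z h (z.2, z.1).
Proof.
move=> mh h0.
have msw : measurable_fun setT (fun z : X * X => (z.2, z.1)) by mtuple.
rewrite (ge0_integral_density
  (nu := measure_function_pushforward__canonical__measure_function_Measure
    (basek tt) msw))//.
  by rewrite ge0_integral_pushforward.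
move=> C mC.
have mC1 : measurable_fun setT (fun x : X * X => (\1_C x)%:E : \bar R).
  exact/measurable_EFinP.
rewrite /basek ge0_integral_kjoint; first last.
- by apply: emeasurable_funM => //; exact/measurable_EFinP.
- by move=> z; rewrite mule_ge0 ?lee_fin.
rewrite r_RN//.
transitivity (\int[basek tt]_z (\1_C (z.2, z.1))%:E).
  rewrite /basek ge0_integral_kjoint//.
  by apply: (measurableT_comp mC1).
transitivity (\int[basek tt]_z
    (\1_((fun z : X * X => (z.2, z.1)) @^-1` C) z)%:E); first by [].
rewrite integral_indic// ?setIT//.
by rewrite -[X in measurable X]setTI; exact: msw.
Qed.

Let mr_swap : measurable_fun setT (fun z : X * X => r z.2 z.1).
Proof.
have msw : measurable_fun setT (fun z : X * X => (z.2, z.1)) by mtuple.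
exact: (measurableT_comp mr msw).
Qed.

(** Exchanging twice is the identity, so r(x, y) r(y, x) has the same integral as 1 over every
    measurable set. *)
Lemma ratio_swap_ae :
  {ae basek tt, forall z : X * X, (r z.1 z.2 * r z.2 z.1 = 1)%R}.
Proof.
have f1 : (basek tt).-integrable setT (fun=> 1 : \bar R).
  apply/integrableP; split; first exact: measurable_cst.
  under eq_integral do rewrite abse1.
  rewrite integral_cst// mul1e.
  by have [b kb] := measure_uub basek; apply: lt_le_trans (kb tt) _; rewrite leey.
have mg : measurable_fun setT (fun z : X * X => (r z.1 z.2 * r z.2 z.1)%:E).
  by apply/measurable_EFinP; exact: measurable_funM.
have [|N [mN N0 sN]] := integral_ae_eq measurableT f1 mg.
  move=> E _ mE; rewrite [LHS]integral_mkcond [RHS]integral_mkcond.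
  transitivity (\int[basek tt]_z (\1_E z)%:E).
    apply: eq_integral => z _. by rewrite patchE indicE; case: (z \in E).
  have msw : measurable_fun setT (fun z : X * X => (z.2, z.1)) by mtuple.
  have mE1 : measurable_fun setT (fun z : X * X => (\1_E z)%:E : \bar R).
    exact/measurable_EFinP.
  transitivity (\int[basek tt]_z ((r z.1 z.2)%:E * (\1_E (z.2, z.1))%:E)).
    rewrite (ge0_integral_basek_swap (h := fun z => (\1_E (z.2, z.1))%:E))//.
    + by apply: eq_integral => -[].
    + exact: (measurableT_comp mE1 msw).
  rewrite -(ge0_integral_basek_swap (h := fun z => (r z.2 z.1)%:E * (\1_E z)%:E)).
  - by apply: eq_integral => z _; rewrite patchE indicE EFinM muleA;
      case: (z \in E); rewrite ?mule1 ?mule0.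
  - by apply: emeasurable_funM => //; exact/measurable_EFinP.
  - by move=> z; rewrite mule_ge0 ?lee_fin.
exists N; split => // z /= zr; apply: sN => /= /(_ Logic.I) [] zr'.
by apply: zr.
Qed.

(** Detailed balance. [M] itself need not be symmetric: exchange multiplies it by [r]. The premise
    relating [k] to [r] says that [k] compensates this factor, so that k dM is invariant. *)
Lemma ge0_integral_movek_swap (k : (X * R) * (X * R) -> R) G :
  measurable_fun setT k -> (forall z, (0 <= k z)%R) ->
  (forall z z', (r z.1 z'.1 * r z'.1 z.1 = 1)%R ->
    (r z.1 z'.1 * k (z', z) = k (z, z'))%R) ->
  measurable_fun setT G -> (forall z, 0 <= G z) ->
  \int[movek tt]_z ((k z)%:E * G z) =
  \int[movek tt]_z ((k z)%:E * G (z.2, z.1)).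
Proof.
move=> mk k0 kr mG G0.
have msw : measurable_fun setT (fun z : (X * R) * (X * R) => (z.2, z.1)) by mtuple.
have mkG : measurable_fun setT (fun z => (k z)%:E * G z).
  by apply: emeasurable_funM => //; exact/measurable_EFinP.
have mkG' : measurable_fun setT (fun z => (k z)%:E * G (z.2, z.1)).
  apply: emeasurable_funM; first exact/measurable_EFinP.
  exact: (measurableT_comp mG msw).
have kG0 z : 0 <= (k z)%:E * G z by rewrite mule_ge0 ?lee_fin.
have kG0' z : 0 <= (k z)%:E * G (z.2, z.1) by rewrite mule_ge0 ?lee_fin.
rewrite (ge0_integral_movek mkG kG0) (ge0_integral_movek mkG' kG0').
have msw' : measurable_fun setT (fun z : X * X => (z.2, z.1)) by mtuple.
have S0 (F : (X * R) * (X * R) -> \bar R) xy :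
    (forall z, 0 <= F z) -> 0 <= section_int F xy.
  by move=> F0; apply: integral_ge0 => ? _; exact: integral_ge0.
transitivity (\int[basek tt]_z ((r z.1 z.2)%:E *
    section_int (fun z => (k z)%:E * G z) (z.2, z.1))).
  rewrite (ge0_integral_basek_swap (h := fun z =>
    section_int (fun z => (k z)%:E * G z) (z.2, z.1))).
  - by apply: eq_integral => -[].
  - exact: (measurableT_comp (measurable_section_int mkG) msw').
  - by move=> z; exact: S0.
apply: ae_eq_integral => //.
- apply: emeasurable_funM; first exact/measurable_EFinP.
  exact: (measurableT_comp (measurable_section_int mkG) msw').
- exact: measurable_section_int.
apply: filterS ratio_swap_ae => -[x y] /= rxy _.
(* The exchange also swaps the order of the two weight integrals, which Tonelli restores. *)
rewrite /section_int /= (@fker_tonelli _ _ _ _ _ _ _ _ _ Q Q x y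
  (fun wu => (k ((x, wu.1), (y, wu.2)))%:E * G ((y, wu.2), (x, wu.1))))//.
  have mt : measurable_fun setT (fun t : R * R => ((y, t.1), (x, t.2))) by mtuple.
  rewrite -ge0_integralZl//; first last.
  - by rewrite lee_fin.
  - by move=> u _; exact: integral_ge0.
  - have m2 : measurable_fun setT (fun t : R => x) by mtuple.
    exact: (measurable_integral_kernel (kpre Q m2) (measurableT_comp mkG mt)).
  apply: eq_integral => u _.
  rewrite -ge0_integralZl//; first last.
  - by rewrite lee_fin.
  - exact: (measurableT_comp (measurableT_comp mkG mt) (pair1_measurable u)).
  by apply: eq_integral => w _; rewrite muleA -EFinM (kr (x, w) (y, u)).
have mt : measurable_fun setT (fun t : R * R => ((x, t.1), (y, t.2))) by mtuple.
exact: (measurableT_comp mkG' mt).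
Qed.

End reversible_pair.

(** * Dirichlet forms *)

Lemma integrable_integral_kernel_signed {dA dB dC : measure_display}
    {A : measurableType dA} {B : measurableType dB} {C : measurableType dC}
    {R : realType} (l : R.-fker A ~> B) (k : R.-fker B ~> C) a
    (f : B * C -> \bar R) :
  (kjoint l k a).-integrable setT f ->
  (l a).-integrable setT (fun b => \int[k b]_c f (b, c)).
Proof.
move=> fi; have mf := measurable_int _ fi.
have mfb b : measurable_fun setT (fun c => f (b, c)) by exact: measurable_fun_pair2.
have := @integrable_integral_kernel _ _ _ _ _ _ _ l k a (abse \o f)
  (fun=> abse_ge0 _) (integrable_abse fi).
apply: le_integrable => //; first exact: measurable_integral_kernel.
move=> b _ /=; rewrite [leRHS]gee0_abs ?integral_ge0//.
exact: le_abse_integral.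
Qed.

Section dirichlet_form.
Context {d : measure_display} {X : measurableType d} {R : realType}.
Variables (pi : probability X R) (q : R.-pker X ~> X) (Q : R.-pker X ~> R).
Hypothesis Q_lt0 : forall x, Q x [set w : R | (w < 0)%R] = 0.
Hypothesis Q_mean : forall x, \int[Q x]_w w%:E = 1.

Let Z := (X * R)%type.
Let hat := hatk pi Q tt.
Let M := movek pi q Q tt.
Let K := propk q Q.

(* [Q x] charges no negative number, so replacing [w] by its positive part
   changes no integral and makes every weight nonnegative everywhere. *)
Definition wp (w : R) : R := Num.max w 0%R.

Lemma wp_ge0 w : (0 <= wp w)%R.
Proof. by rewrite /wp le_max lexx orbT. Qed.

Lemma measurable_wp : measurable_fun setT wp.
Proof. by apply: measurable_maxr. Qed.

Lemma wp_ae x : {ae Q x, forall w, wp w = w}.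
Proof.
have mN : measurable [set w : R | (w < 0)%R].
  rewrite (_ : mkset _ = `]-oo, 0%R[%classic); first exact: measurable_itv.
  by apply/seteqP; split => w /=; rewrite in_itv.
exists [set w : R | (w < 0)%R]; split => // w /=.
apply: contra_notP => /negP; rewrite -leNgt => w0.
by rewrite /wp; apply/max_idPl.
Qed.

Lemma integral_wp (x : X) (g : R -> \bar R) : measurable_fun setT g ->
  \int[Q x]_w (w%:E * g w) = \int[Q x]_w ((wp w)%:E * g w).
Proof.
move=> mg; apply: ae_eq_integral => //.
- exact: emeasurable_funM.
- apply: emeasurable_funM => //; apply/measurable_EFinP; exact: measurable_wp.
by apply: filterS (wp_ae x) => w -> _.
Qed.

Lemma wp_mean x : \int[Q x]_w (wp w)%:E = 1.
Proof.
rewrite -(Q_mean x); apply: ae_eq_integral => //.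
  by apply/measurable_EFinP; exact: measurable_wp.
by apply: filterS (wp_ae x) => w -> _.
Qed.

Lemma measurable_wp2 : measurable_fun setT (fun z : Z => wp z.2).
Proof. exact: (measurableT_comp measurable_wp measurable_snd). Qed.

Lemma ge0_pit_int (g : Z -> \bar R) : measurable_fun setT g ->
  (forall z, 0 <= g z) ->
  pit_int pi Q g = \int[hat]_z ((wp z.2)%:E * g z).
Proof.
move=> mg g0; rewrite /hat /hatk [RHS]ge0_integral_kjoint; first last.
- apply: emeasurable_funM => //.
  apply/measurable_EFinP; exact: measurable_wp2.
- by move=> z; rewrite mule_ge0 ?lee_fin ?wp_ge0.
apply: eq_integral => x _; apply: integral_wp.
exact: (measurableT_comp mg (pair1_measurable x)).
Qed.

(** The integrand of a Dirichlet form is signed, so the iterated integral needs Fubini and thus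
    integrability. *)
Lemma integrable_pit_int (g : Z -> \bar R) : measurable_fun setT g ->
  hat.-integrable setT (fun z => (wp z.2)%:E * g z) ->
  pit_int pi Q g = \int[hat]_z ((wp z.2)%:E * g z).
Proof.
move=> mg gi; rewrite /hat /hatk [RHS]integral_kjoint; last exact: gi.
apply: eq_integral => x _; apply: integral_wp.
exact: (measurableT_comp mg (pair1_measurable x)).
Qed.

End dirichlet_form.

(** * The Dirichlet form of a reversible kernel with an abstract move density *)

Section dirichlet_form_identity.
Context {d : measure_display} {X : measurableType d} {R : realType}.
Variables (pi : probability X R) (q : R.-pker X ~> X) (Q : R.-pker X ~> R).
Hypothesis Q_lt0 : forall x, Q x [set w : R | (w < 0)%R] = 0.

Let Z := (X * R)%type.
Let hat := hatk pi Q tt.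
Let M := movek pi q Q tt.
Let K := propk q Q.

Variable r : X -> X -> R.
Hypothesis mr : measurable_fun setT (fun xy : X * X => r xy.1 xy.2).
Hypothesis r0 : forall x y, (0 <= r x y)%R.
Hypothesis r_RN : forall C : set (X * X), measurable C ->
     \int[pi]_x \int[q x]_y ((r x y)%:E * (\1_C (x, y))%:E)
     = \int[pi]_x \int[q x]_y (\1_C (y, x))%:E.

Variable c : Z * Z -> R.
Hypothesis mc : measurable_fun setT c.
Hypothesis c0 : forall t, (0 <= c t)%R.
Hypothesis c_le1 : forall z, \int[K z.1]_z' (c (z, z'))%:E <= 1.
Hypothesis c_sym : forall z z', (r z.1 z'.1 * r z'.1 z.1 = 1)%R ->
  (r z.1 z'.1 * (wp z'.2 * c (z', z)) = wp z.2 * c (z, z'))%R.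

Definition edge_weight (t : Z * Z) : R := (wp t.1.2 * c t)%R.
Let k := edge_weight.

Lemma edge_weight_ge0 t : (0 <= k t)%R.
Proof. by rewrite mulr_ge0// wp_ge0. Qed.

Lemma measurable_edge_weight : measurable_fun setT k.
Proof.
apply: measurable_funM => //.
exact: (measurableT_comp measurable_wp2 measurable_fst).
Qed.

Lemma ge0_integral_edge_swap (G : Z * Z -> \bar R) :
  measurable_fun setT G -> (forall z, 0 <= G z) ->
  \int[M]_z ((k z)%:E * G z) = \int[M]_z ((k z)%:E * G (z.2, z.1)).
Proof.
move=> mG G0; apply: (@ge0_integral_movek_swap _ _ _ _ _ _ r) => //.
- exact: measurable_edge_weight.
- exact: edge_weight_ge0.
Qed.

(** Integrating out the second point costs the mass of c(z, .), which is at most 1: the first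
    marginal of k dM is dominated by pi~. *)
Lemma ge0_integral_edge_fst (g : Z -> \bar R) : measurable_fun setT g ->
  (forall z, 0 <= g z) ->
  \int[M]_t ((k t)%:E * g t.1) <= \int[hat]_z ((wp z.2)%:E * g z).
Proof.
move=> mg g0.
have mkg : measurable_fun setT (fun t : Z * Z => (k t)%:E * g t.1).
  apply: emeasurable_funM.
    by apply/measurable_EFinP; exact: measurable_edge_weight.
  exact: (measurableT_comp mg measurable_fst).
have kg0 (t : Z * Z) : 0 <= (k t)%:E * g t.1.
  by rewrite mule_ge0 ?lee_fin ?edge_weight_ge0.
rewrite /M /movek [leLHS]ge0_integral_kjoint; [|exact: kg0|exact: mkg].
apply: ge0_le_integral => //.
- by move=> z _; exact: integral_ge0.
- exact: (measurable_integral_kernel (propzk q Q) mkg).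
- apply: emeasurable_funM => //.
  by apply/measurable_EFinP; exact: measurable_wp2.
move=> z _; pose a := (wp z.2)%:E * g z.
have a0 : 0 <= a by rewrite mule_ge0 ?lee_fin ?wp_ge0.
have -> : \int[propzk q Q z]_z' ((k (z, z'))%:E * g (z, z').1) =
    \int[K z.1]_z' (a * (c (z, z'))%:E).
  apply: eq_integral => z' _.
  by rewrite /k /edge_weight /a EFinM /= -!muleA; congr (_ * _); rewrite muleC.
rewrite ge0_integralZl//; first last.
- by move=> z' _; rewrite lee_fin.
- by apply/measurable_EFinP; exact: (measurableT_comp mc (pair1_measurable z)).
by rewrite -[leRHS]mule1; exact: lee_wpmul2l.
Qed.

Lemma ge0_integral_edge_snd (g : Z -> \bar R) : measurable_fun setT g ->
  (forall z, 0 <= g z) ->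
  \int[M]_t ((k t)%:E * g t.2) <= \int[hat]_z ((wp z.2)%:E * g z).
Proof.
move=> mg g0; rewrite (ge0_integral_edge_swap (G := fun t => g t.2))//.
  exact: ge0_integral_edge_fst.
exact: (measurableT_comp mg measurable_snd).
Qed.

Variable f : Z -> R.
Hypothesis mf : measurable_fun setT f.
Hypothesis f2 : \int[hat]_z ((wp z.2)%:E * (f z ^+ 2)%:E) < +oo.

Let mf2 : measurable_fun setT (fun z => (f z ^+ 2)%:E).
Proof. by apply/measurable_EFinP; exact: measurable_funX. Qed.

Lemma integrable_edge (g : Z * Z -> R) :
  measurable_fun setT g -> (forall t, (0 <= g t)%R) ->
  \int[M]_t ((k t)%:E * (g t)%:E) < +oo ->
  M.-integrable setT (fun t => (k t * g t)%:E).
Proof.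
move=> mg g0 goo; apply/integrableP; split.
  apply/measurable_EFinP; apply: measurable_funM => //.
  exact: measurable_edge_weight.
apply: le_lt_trans goo; rewrite le_eqVlt; apply/orP; left; apply/eqP.
apply: eq_integral => t _.
by rewrite -EFinM gee0_abs// lee_fin mulr_ge0// edge_weight_ge0.
Qed.

Let if1 : M.-integrable setT (fun t => (k t * f t.1 ^+ 2)%:E).
Proof.
apply: (@integrable_edge (fun t => f t.1 ^+ 2)%R).
- exact: (measurableT_comp (measurable_funX 2 mf) measurable_fst).
- by move=> t; exact: sqr_ge0.
apply: le_lt_trans f2.
apply: (@ge0_integral_edge_fst (fun z => (f z ^+ 2)%:E)) => //.
by move=> z; rewrite lee_fin sqr_ge0.
Qed.

Let if2 : M.-integrable setT (fun t => (k t * f t.2 ^+ 2)%:E).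
Proof.
apply: (@integrable_edge (fun t => f t.2 ^+ 2)%R).
- exact: (measurableT_comp (measurable_funX 2 mf) measurable_snd).
- by move=> t; exact: sqr_ge0.
apply: le_lt_trans f2.
apply: (@ge0_integral_edge_snd (fun z => (f z ^+ 2)%:E)) => //.
by move=> z; rewrite lee_fin sqr_ge0.
Qed.

Let mdelta : measurable_fun setT (fun t : Z * Z => f t.1 - f t.2)%R.
Proof.
apply: measurable_funB.
  exact: (measurableT_comp mf measurable_fst).
exact: (measurableT_comp mf measurable_snd).
Qed.

Lemma integrable_edge_delta :
  M.-integrable setT (fun t => (k t * (f t.1 - f t.2) ^+ 2)%:E).
Proof.
have := integrableZl measurableT 2 (integrableD measurableT if1 if2).
apply: le_integrable => //.
  apply/measurable_EFinP; apply: measurable_funM; last exact: measurable_funX.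
  exact: measurable_edge_weight.
move=> t _; have k_ge0 := edge_weight_ge0 t.
have a0 : (0 <= k t * f t.1 ^+ 2)%R by rewrite mulr_ge0 ?sqr_ge0.
have b0 : (0 <= k t * f t.2 ^+ 2)%R by rewrite mulr_ge0 ?sqr_ge0.
have d0 : (0 <= k t * (f t.1 - f t.2) ^+ 2)%R by rewrite mulr_ge0 ?sqr_ge0.
(* This is exactly the slack in (a - b)^2 <= 2 (a^2 + b^2). *)
have e0 : (0 <= k t * (f t.1 + f t.2) ^+ 2)%R by rewrite mulr_ge0 ?sqr_ge0.
rewrite /= lee_fin (ger0_norm d0) ger0_norm; last by rewrite mulr_ge0// addr_ge0.
by rewrite -subr_ge0; apply: le_trans e0 _; rewrite le_eqVlt; apply/orP; left;
  apply/eqP; ring.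
Qed.

(* The cross term is expanded so that the symmetry of the weight is needed for
   nonnegative integrands only. *)
Let polarization t : (k t * (f t.1 * (f t.1 - f t.2)))%:E =
  (2^-1)%:E * ((k t * (f t.1 - f t.2) ^+ 2)%:E + (k t * f t.1 ^+ 2)%:E
    - (k t * f t.2 ^+ 2)%:E).
Proof. by apply: (congr1 (@EFin R)); rewrite /=; field. Qed.

Lemma integrable_edge_polar :
  M.-integrable setT (fun t => (k t * (f t.1 * (f t.1 - f t.2)))%:E).
Proof.
under eq_fun do rewrite polarization.
apply: integrableZl => //; apply: integrableB => //; apply: integrableD => //.
exact: integrable_edge_delta.
Qed.

Lemma integral_edge_polar :
  \int[M]_t (k t * (f t.1 * (f t.1 - f t.2)))%:E =
  (2^-1)%:E * \int[M]_t ((k t)%:E * ((f t.1 - f t.2) ^+ 2)%:E).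
Proof.
have iD := integrable_edge_delta.
under eq_integral do rewrite polarization.
rewrite integralZl//; last first.
  by apply: integrableB => //; exact: integrableD.
congr (_ * _); rewrite integralB//; last exact: integrableD.
rewrite integralD//.
(* Symmetry makes the two square terms equal; being finite, they cancel and only the squared
   difference survives. *)
have -> : \int[M]_t (k t * f t.1 ^+ 2)%:E = \int[M]_t (k t * f t.2 ^+ 2)%:E.
  under eq_integral do rewrite EFinM.
  under [RHS]eq_integral do rewrite EFinM.
  apply: (@ge0_integral_edge_swap (fun t => (f t.1 ^+ 2)%:E)).
    exact: (measurableT_comp mf2 measurable_fst).
  by move=> t; rewrite lee_fin sqr_ge0.
rewrite addeK; last exact: integrable_fin_num.
by apply: eq_integral => t _; rewrite EFinM.
Qed.

Variable T : Z -> \bar R.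
Hypothesis mT : measurable_fun setT T.
(* [T z] may be the junk value of a non-integrable integral off a null set,
   hence the integrability premise; nothing is required where [w <= 0]. *)
Hypothesis TE : forall z, (0 < z.2)%R ->
  (K z.1).-integrable setT (fun z' => (c (z, z') * f z')%:E) ->
  T z = \int[K z.1]_z' (c (z, z') * f z')%:E
        + (1 - \int[K z.1]_z' (c (z, z'))%:E) * (f z)%:E.

(** The rejection part cancels in f - T f, leaving the integral of c(z, z') (f z - f z'). The
    exceptional set consists of points where c(z, .) f^2 may fail to be integrable although w >
    0. *)
Lemma carre_du_champ_ae : {ae hat, forall z,
  (wp z.2)%:E * ((f z)%:E * ((f z)%:E - T z)) =
  \int[propzk q Q z]_z' (k (z, z') * (f z * (f z - f z')))%:E}.
Proof.
apply: filterS (integrable_kjoint_ae if2) => z /= iz.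
have [w0|w0] := eqVneq (wp z.2) 0%R.
  rewrite w0 mul0e integral0_eq// => z' _.
  by rewrite /k /edge_weight /= w0 !mul0r.
have {w0} w_gt0 : (0 < wp z.2)%R by rewrite lt_neqAle eq_sym w0 wp_ge0.
have z_gt0 : (0 < z.2)%R by move: w_gt0; rewrite /wp lt_max ltxx orbF.
have mcz : measurable_fun setT (fun z' => c (z, z')).
  exact: (measurableT_comp mc (pair1_measurable z)).
have ic : (K z.1).-integrable setT (fun z' => (c (z, z'))%:E).
  apply/integrableP; split; first exact/measurable_EFinP.
  under eq_integral do rewrite gee0_abs ?lee_fin//.
  by apply: le_lt_trans (c_le1 z) _; rewrite ltry.
have icf : (K z.1).-integrable setT (fun z' => (c (z, z') * f z')%:E).
  (* The bound c |f| <= c (1 + f^2) reduces the claim to the square, whose weight w > 0 is divided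
     out. *)
  have := integrableD measurableT ic (integrableZl measurableT (wp z.2)^-1 iz).
  apply: le_integrable => //.
    by apply/measurable_EFinP; exact: measurable_funM.
  move=> z' _ /=; rewrite lee_fin /k /edge_weight /=.
  rewrite -mulrA mulKf ?gt_eqF// normrM (ger0_norm (c0 _)).
  rewrite [leRHS]ger0_norm; last by rewrite addr_ge0// mulr_ge0// sqr_ge0.
  rewrite -{2}[c _]mulr1 -mulrDr ler_wpM2l// -real_normK ?num_real//.
  have := sqr_ge0 (`|f z'| - 2^-1)%R; have := normr_ge0 (f z'); nra.
rewrite (TE z_gt0 icf).
have fB := integrable_fin_num measurableT ic.
have fA := integrable_fin_num measurableT icf.
transitivity (\int[K z.1]_z' ((wp z.2 * f z * f z)%:E * (c (z, z'))%:E
   - (wp z.2 * f z)%:E * (c (z, z') * f z')%:E)); last first.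
  by apply: eq_integral => z' _; rewrite -!EFinM -EFinB; congr EFin;
    rewrite /k /edge_weight /=; ring.
rewrite integralB//; [|exact: integrableZl|exact: integrableZl].
rewrite !integralZl//.
rewrite -(fineK fA) -(fineK fB).
by rewrite -?EFinM -?EFinD -?EFinM -?EFinD; congr EFin; ring.
Qed.

Lemma dirichletE :
  dirichlet pi Q T f =
  (2^-1)%:E * \int[M]_t ((k t)%:E * ((f t.1 - f t.2) ^+ 2)%:E).
Proof.
have mg : measurable_fun setT (fun z => (f z)%:E * ((f z)%:E - T z)).
  apply: emeasurable_funM; first exact/measurable_EFinP.
  by apply: emeasurable_funB => //; exact/measurable_EFinP.
have mL : measurable_fun setT
    (fun z => (wp z.2)%:E * ((f z)%:E * ((f z)%:E - T z))).
  apply: emeasurable_funM => //.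
  by apply/measurable_EFinP; exact: measurable_wp2.
have iH := integrable_integral_kernel_signed integrable_edge_polar.
have LH : ae_eq hat setT
    (fun z => (wp z.2)%:E * ((f z)%:E * ((f z)%:E - T z)))
    (fun z => \int[propzk q Q z]_z' (k (z, z') * (f z * (f z - f z')))%:E).
  by apply: filterS carre_du_champ_ae => z zE _.
(* Integrability passes from the carre du champ, which is controlled on pairs, to the integrand
   containing [T]. *)
have iL : hat.-integrable setT
    (fun z => (wp z.2)%:E * ((f z)%:E * ((f z)%:E - T z))).
  have /integrableP[mH Hoo] := iH.
  apply/integrableP; split => //; apply: le_lt_trans Hoo.
  rewrite le_eqVlt; apply/orP; left; apply/eqP.
  apply: ae_eq_integral => //; [exact: measurableT_comp|exact: measurableT_comp|].
  exact: ae_eq_abse.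
rewrite /dirichlet integrable_pit_int; [|exact: Q_lt0|exact: mg|exact: iL].
transitivity (\int[hat]_z
    \int[propzk q Q z]_z' (k (z, z') * (f z * (f z - f z')))%:E).
  by apply: ae_eq_integral => //; exact: measurable_int iH.
rewrite -integral_edge_polar.
by rewrite /M /movek [RHS]integral_kjoint; last exact: integrable_edge_polar.
Qed.

End dirichlet_form_identity.

(** The real power is taken of the nonnegative x^2; the factor x restores the sign and gives the
    value 0 at 0. *)
Lemma measurable_invr {R : realType} : measurable_fun setT (@GRing.inv R).
Proof.
rewrite (_ : @GRing.inv R = fun x => (x * (x ^+ 2) `^ (- 1))%R).
  apply: measurable_funM => //.
  exact: (measurableT_comp (@measurable_powR R (- 1))
    (measurable_funX 2 (@measurable_id _ _ setT))).
apply/funext => x; rewrite powR_inv1 ?sqr_ge0//.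
have [->|x0] := eqVneq x 0%R; first by rewrite invr0 mul0r.
by field.
Qed.

(** * The two kernels as instances of the abstract move density *)

Section pseudo_marginal_forms.
Context {d : measure_display} {X : measurableType d} {R : realType}.
Variables (pi : probability X R) (q : R.-pker X ~> X) (Q : R.-pker X ~> R).
Hypothesis Q_lt0 : forall x, Q x [set w : R | (w < 0)%R] = 0.
Hypothesis Q_mean : forall x, \int[Q x]_w w%:E = 1.

Let Z := (X * R)%type.
Let hat := hatk pi Q tt.
Let M := movek pi q Q tt.
Let K := propk q Q.

Variable r : X -> X -> R.
Hypothesis mr : measurable_fun setT (fun xy : X * X => r xy.1 xy.2).
Hypothesis r0 : forall x y, (0 <= r x y)%R.
Hypothesis r_RN : forall C : set (X * X), measurable C ->
     \int[pi]_x \int[q x]_y ((r x y)%:E * (\1_C (x, y))%:E)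
     = \int[pi]_x \int[q x]_y (\1_C (y, x))%:E.

Variable f : Z -> R.
Hypothesis mf : measurable_fun setT f.
Hypothesis f2 : \int[hat]_z ((wp z.2)%:E * (f z ^+ 2)%:E) < +oo.

Lemma measurable_integral_prop (G : Z * Z -> \bar R) : measurable_fun setT G ->
  measurable_fun setT (fun z => \int[q z.1]_y \int[Q y]_u G (z, (y, u))).
Proof.
move=> mG.
have m1 : measurable_fun setT (fun t : Z * X => t.2) by mtuple.
have mG' : measurable_fun setT (fun t : (Z * X) * R => G (t.1.1, (t.1.2, t.2))).
  by apply: measurableT_comp => //; mtuple.
have m2 : measurable_fun setT (fun z : Z => z.1) by mtuple.
have := measurable_integral_kernel (kpre Q m1) mG'.
by move=> /(measurable_integral_kernel (kpre q m2)).
Qed.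

(** Passes from the formulas in the definitions of the operators, written with the raw weight u, to
    those with its positive part. *)
Lemma integral_propk x (g h : X * R -> \bar R) : (K x).-integrable setT g ->
  measurable_fun setT h ->
  (forall y u, wp u = u -> h (y, u) = g (y, u)) ->
  \int[q x]_y \int[Q y]_u h (y, u) = \int[K x]_z' g z'.
Proof.
move=> ig mh hg; have mg := measurable_int _ ig.
rewrite /K /propk [RHS]integral_kjoint; last exact: ig.
apply: eq_integral => y _; apply: ae_eq_integral => //.
- exact: (measurableT_comp mh (pair1_measurable y)).
- exact: (measurableT_comp mg (pair1_measurable y)).
by apply: filterS (wp_ae Q_lt0 y) => u wu _; exact: hg.
Qed.

Let mr2 : measurable_fun setT (fun t : Z * Z => r t.1.1 t.2.1).
Proof.
have mt : measurable_fun setT (fun t : Z * Z => (t.1.1, t.2.1)) by mtuple.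
exact: (measurableT_comp mr mt).
Qed.

Let mw1 : measurable_fun setT (fun t : Z * Z => wp t.1.2).
Proof. exact: (measurableT_comp measurable_wp2 measurable_fst). Qed.

Let mw2 : measurable_fun setT (fun t : Z * Z => wp t.2.2).
Proof. exact: (measurableT_comp measurable_wp2 measurable_snd). Qed.

Definition c_bar (t : Z * Z) : R := (Num.min 1 (r t.1.1 t.2.1) * wp t.2.2)%R.

(* At [w = 0] the division gives [0]; this is harmless because [c_tilde] is only
   used multiplied by [w]. *)
Definition c_tilde (t : Z * Z) : R :=
  Num.min 1%R (r t.1.1 t.2.1 * wp t.2.2 / wp t.1.2)%R.

Lemma min1_ge0 (a : R) : (0 <= a)%R -> (0 <= Num.min 1 a)%R.
Proof. by move=> a0; rewrite le_min ler01. Qed.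

Lemma min1_le1 (a : R) : (Num.min 1 a <= 1)%R.
Proof. by rewrite ge_min lexx. Qed.

Lemma measurable_c_bar : measurable_fun setT c_bar.
Proof.
by apply: measurable_funM => //; apply: measurable_minr.
Qed.

Lemma measurable_c_tilde : measurable_fun setT c_tilde.
Proof.
apply: measurable_minr => //; apply: measurable_funM.
  exact: measurable_funM.
exact: (measurableT_comp measurable_invr mw1).
Qed.

Lemma c_bar_ge0 t : (0 <= c_bar t)%R.
Proof. by rewrite mulr_ge0 ?min1_ge0 ?wp_ge0. Qed.

Lemma c_tilde_ge0 t : (0 <= c_tilde t)%R.
Proof. by rewrite min1_ge0// !mulr_ge0 ?invr_ge0 ?wp_ge0. Qed.

(** The Metropolis-Hastings identity 1 /\ r(x, y) = r(x, y) (1 /\ r(y, x)). *)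
Lemma c_bar_sym z z' : (r z.1 z'.1 * r z'.1 z.1 = 1)%R ->
  (r z.1 z'.1 * (wp z'.2 * c_bar (z', z)) = wp z.2 * c_bar (z, z'))%R.
Proof.
move=> rr; rewrite /c_bar /=.
rewrite (_ : Num.min 1 (r z.1 z'.1) = r z.1 z'.1 * Num.min 1 (r z'.1 z.1))%R.
  by ring.
by rewrite minr_pMr// rr mulr1 minC.
Qed.

(** Both sides equal w /\ (r(x, y) u). A zero weight is treated apart because it occurs as a
    denominator; both sides are then 0. *)
Lemma c_tilde_sym z z' : (r z.1 z'.1 * r z'.1 z.1 = 1)%R ->
  (r z.1 z'.1 * (wp z'.2 * c_tilde (z', z)) = wp z.2 * c_tilde (z, z'))%R.
Proof.
move=> rr; rewrite /c_tilde /=.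
have := wp_ge0 z.2; have := wp_ge0 z'.2.
move: (wp z.2) (wp z'.2) => w u u0 w0.
have [->|w_neq0] := eqVneq w 0%R.
  by rewrite mulr0 !mul0r minElt ltNge ler01 /= !mulr0.
have [->|u_neq0] := eqVneq u 0%R.
  by rewrite mulr0 !mul0r minElt ltNge ler01 /= !mulr0.
rewrite mulrA !minr_pMr ?mulr_ge0// !mulr1 minC; congr Num.min.
  by rewrite -[RHS]mul1r -rr; field.
by field.
Qed.

(** The mean-one condition integrates the new weight out, so the rejection probability depends on
    the position only. *)
Lemma c_bar_int z : \int[K z.1]_z' (c_bar (z, z'))%:E =
  \int[q z.1]_y (Num.min 1%R (r z.1 y))%:E.
Proof.
rewrite /K /propk ge0_integral_kjoint; first last.
- apply/measurable_EFinP.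
  exact: (measurableT_comp measurable_c_bar (pair1_measurable z)).
- by move=> z'; rewrite lee_fin c_bar_ge0.
apply: eq_integral => y _; rewrite -[RHS]mule1 -(wp_mean Q_lt0 Q_mean y).
rewrite -ge0_integralZl//; first last.
- by rewrite lee_fin min1_ge0.
- by move=> u _; rewrite lee_fin wp_ge0.
- by apply/measurable_EFinP; exact: measurable_wp.
Qed.

Let mr1 x : measurable_fun setT (r x).
Proof. exact: (measurableT_comp mr (pair1_measurable x)). Qed.

Lemma c_bar_le1 z : \int[K z.1]_z' (c_bar (z, z'))%:E <= 1.
Proof.
rewrite c_bar_int; apply: (@le_trans _ _ (\int[q z.1]_y 1)).
  apply: ge0_le_integral => //.
  - by move=> y _; rewrite lee_fin min1_ge0.
  - by apply/measurable_EFinP; apply: measurable_minr.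
  - by move=> y _; rewrite lee_fin min1_le1.
by rewrite integral_cst// mul1e prob_kernel.
Qed.

Lemma c_tilde_le1 z : \int[K z.1]_z' (c_tilde (z, z'))%:E <= 1.
Proof.
apply: (@le_trans _ _ (\int[K z.1]__ 1)).
  apply: ge0_le_integral => //.
  - by move=> z' _; rewrite lee_fin c_tilde_ge0.
  - apply/measurable_EFinP.
    exact: (measurableT_comp measurable_c_tilde (pair1_measurable z)).
  - by move=> z' _; rewrite lee_fin min1_le1.
rewrite /K /propk ge0_integral_kjoint; [|by []|exact: measurable_cst].
under eq_integral do rewrite integral_cst// mul1e prob_kernel.
by rewrite integral_cst// mul1e prob_kernel.
Qed.

Let f_snd : measurable_fun setT (fun t : Z * Z => f t.2).
Proof. exact: (measurableT_comp mf measurable_snd). Qed.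

Let u_snd : measurable_fun setT (fun t : Z * Z => t.2.2).
Proof. by mtuple. Qed.

Lemma dirichlet_bar : dirichlet pi Q (Pbar_op q Q r f) f =
  (2^-1)%:E * \int[M]_t ((edge_weight c_bar t)%:E * ((f t.1 - f t.2) ^+ 2)%:E).
Proof.
have mh : measurable_fun setT (fun t : Z * Z =>
  (Num.min 1%R (r t.1.1 t.2.1))%:E * (t.2.2%:E * (f t.2)%:E)).
  apply: emeasurable_funM.
    by apply/measurable_EFinP; apply: measurable_minr.
  by apply: emeasurable_funM; exact/measurable_EFinP.
apply: (@dirichletE _ _ _ _ _ _ Q_lt0 r) => //.
- exact: measurable_c_bar.
- exact: c_bar_ge0.
- exact: c_bar_le1.
- exact: c_bar_sym.
- rewrite /Pbar_op; apply: emeasurable_funD.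
    exact: (measurable_integral_prop mh).
  apply: emeasurable_funM; last exact/measurable_EFinP.
  apply: emeasurable_funB; first exact: measurable_cst.
  have m2 : measurable_fun setT (fun z : Z => z.1) by mtuple.
  apply: (measurable_integral_kernel (kpre q m2)
    (f := fun t : Z * X => (Num.min 1%R (r t.1.1 t.2))%:E)).
  apply/measurable_EFinP; apply: measurable_minr => //.
  have mt : measurable_fun setT (fun t : Z * X => (t.1.1, t.2)) by mtuple.
  exact: (measurableT_comp mr mt).
move=> z _ ic; rewrite /Pbar_op c_bar_int; congr (_ + _).
apply: (integral_propk ic (h := fun z' =>
  (Num.min 1%R (r z.1 z'.1))%:E * (z'.2%:E * (f z')%:E))).
  exact: (measurableT_comp mh (pair1_measurable z)).
by move=> y u wu; rewrite /c_bar /= wu muleA -!EFinM.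
Qed.

Lemma dirichlet_tilde : dirichlet pi Q (Ptilde_op q Q r f) f =
  (2^-1)%:E * \int[M]_t ((edge_weight c_tilde t)%:E * ((f t.1 - f t.2) ^+ 2)%:E).
Proof.
have ma : measurable_fun setT (fun t : Z * Z =>
    (alpha_pm r t.1.1 t.1.2 t.2.1 t.2.2)%:E : \bar R).
  apply/measurable_EFinP; apply: measurable_minr => //.
  apply: measurable_funM; first exact: measurable_funM.
  have mt : measurable_fun setT (fun t : Z * Z => t.1.2) by mtuple.
  exact: (measurableT_comp measurable_invr mt).
have mh : measurable_fun setT (fun t : Z * Z =>
  (alpha_pm r t.1.1 t.1.2 t.2.1 t.2.2)%:E * (f t.2)%:E).
  by apply: emeasurable_funM => //; exact/measurable_EFinP.
apply: (@dirichletE _ _ _ _ _ _ Q_lt0 r) => //.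
- exact: measurable_c_tilde.
- exact: c_tilde_ge0.
- exact: c_tilde_le1.
- exact: c_tilde_sym.
- rewrite /Ptilde_op; apply: emeasurable_funD.
    exact: (measurable_integral_prop mh).
  apply: emeasurable_funM; last exact/measurable_EFinP.
  apply: emeasurable_funB; first exact: measurable_cst.
  exact: (measurable_integral_prop ma).
move=> z z0 ic; rewrite /Ptilde_op.
(* [Ptilde_op] divides by the raw weight and [c_tilde] by its positive part; they agree as w > 0
   here. *)
have wz : wp z.2 = z.2 by apply/max_idPl; exact: ltW.
congr (_ + (1 - _) * _).
  apply: (integral_propk ic (h := fun z' =>
    (alpha_pm r z.1 z.2 z'.1 z'.2)%:E * (f z')%:E)).
    exact: (measurableT_comp mh (pair1_measurable z)).
  by move=> y u wu; rewrite /c_tilde /= wu wz EFinM.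
have mct : measurable_fun setT (fun z' => c_tilde (z, z')).
  exact: (measurableT_comp measurable_c_tilde (pair1_measurable z)).
apply: (integral_propk (g := fun z' => (c_tilde (z, z'))%:E)
  (h := fun z' => (alpha_pm r z.1 z.2 z'.1 z'.2)%:E)).
- apply/integrableP; split; first exact/measurable_EFinP.
  under eq_integral do rewrite gee0_abs ?lee_fin ?c_tilde_ge0//.
  by apply: le_lt_trans (c_tilde_le1 z) _; rewrite ltry.
- exact: (measurableT_comp ma (pair1_measurable z)).
- by move=> y u wu; rewrite /c_tilde /= wu wz.
Qed.

End pseudo_marginal_forms.

(** * Comparison of the two forms *)

Lemma half_le_of_double_tail {R : realType} (s : R) (L A B : \bar R) :
  (0 <= s)%R -> 0 <= A -> 0 <= B ->
  L <= s%:E * A + (B + B) -> (2^-1)%:E * L <= s%:E * ((2^-1)%:E * A) + B.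
Proof.
move=> s0 A0 B0 LAB.
have h0 : 0 <= (2^-1)%:E :> \bar R by rewrite lee_fin invr_ge0 ler0n.
apply: (le_trans (lee_wpmul2l h0 LAB)).
rewrite ge0_muleDr ?adde_ge0 ?mule_ge0// muleCA leeD2l//.
rewrite ge0_muleDr// -ge0_muleDl// -EFinD.
by rewrite (_ : 2^-1 + 2^-1 = 1)%R ?mul1e//; field.
Qed.

Section tail_comparison.
Context {d : measure_display} {X : measurableType d} {R : realType}.
Variables (pi : probability X R) (q : R.-pker X ~> X) (Q : R.-pker X ~> R).
Hypothesis Q_lt0 : forall x, Q x [set w : R | (w < 0)%R] = 0.
Hypothesis Q_mean : forall x, \int[Q x]_w w%:E = 1.

Let Z := (X * R)%type.
Let hat := hatk pi Q tt.
Let M := movek pi q Q tt.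

Variable r : X -> X -> R.
Hypothesis mr : measurable_fun setT (fun xy : X * X => r xy.1 xy.2).
Hypothesis r0 : forall x y, (0 <= r x y)%R.
Hypothesis r_RN : forall C : set (X * X), measurable C ->
     \int[pi]_x \int[q x]_y ((r x y)%:E * (\1_C (x, y))%:E)
     = \int[pi]_x \int[q x]_y (\1_C (y, x))%:E.

Variable s : R.
Hypothesis s_gt0 : (0 < s)%R.

Let kb := edge_weight (c_bar r).
Let kt := edge_weight (c_tilde r).
Definition tail_ind (z : Z) : R := \1_[set v : R | (s <= v)%R] z.2.

Lemma measurable_tail_ind : measurable_fun setT tail_ind.
Proof.
have m1 : measurable_fun setT (\1_[set v : R | (s <= v)%R] : R -> R).
  apply: measurable_indic.
  rewrite (_ : mkset _ = `[s, +oo[%classic); first exact: measurable_itv.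
  by apply/seteqP; split => w /=; rewrite in_itv/= andbT.
exact: (measurableT_comp m1 measurable_snd).
Qed.

Lemma tail_ind_ge0 z : (0 <= tail_ind z)%R.
Proof. by []. Qed.

Lemma tail_indE z : (tail_ind z = (s <= z.2)%R%:R)%R.
Proof. by rewrite /tail_ind indicE mem_setE. Qed.

Let kb0 t : (0 <= kb t)%R.
Proof. by apply: edge_weight_ge0 => t'; exact: c_bar_ge0. Qed.

Let kt0 t : (0 <= kt t)%R.
Proof. by apply: edge_weight_ge0 => t'; exact: c_tilde_ge0. Qed.

Let mkb : measurable_fun setT kb.
Proof. by apply: measurable_edge_weight; exact: measurable_c_bar. Qed.

Let mkt : measurable_fun setT kt.
Proof. by apply: measurable_edge_weight; exact: measurable_c_tilde. Qed.

Lemma wp_lt (w : R) : (w < s)%R -> (wp w <= s)%R.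
Proof. by move=> ws; rewrite /wp ge_max (ltW ws) ltW. Qed.

(** If one of the weights reaches [s], its tail term alone is already [kb t]; only the case of two
    small weights needs the pseudo-marginal term. *)
Lemma bar_le_tilde t :
  (kb t <= s * kt t + (kb t * tail_ind t.1 + kb t * tail_ind t.2))%R.
Proof.
have h0 : (0 <= s * kt t)%R by rewrite mulr_ge0// ltW.
rewrite !tail_indE; case: (leP s t.1.2) => [_|w1] /=.
  by rewrite mulr1n mulr1 addrCA lerDl addr_ge0// mulr_ge0.
case: (leP s t.2.2) => [_|w2] /=.
  by rewrite mulr1n mulr0n mulr1 mulr0 add0r lerDr.
rewrite !mulr0n !mulr0 !addr0 /kb /kt /edge_weight /c_bar /c_tilde.
have := wp_ge0 t.2.2; have := wp_ge0 t.1.2.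
move: (wp_lt w1) (wp_lt w2); move: (wp t.1.2) (wp t.2.2) => w u ws us w0 u0.
have [->|w_neq0] := eqVneq w 0%R; first by rewrite !mul0r mulr0.
rewrite mulrA !minr_pMr ?mulr_ge0// ?(ltW s_gt0)// mulr1.
rewrite (_ : s * w * (r t.1.1 t.2.1 * u / w) = s * (r t.1.1 t.2.1 * u))%R;
  last by field.
(* For the first bound, w u (1 /\ r) <= w u <= s w uses u <= s; for the second, w u (1 /\ r) <= w (r
   u) <= s (r u) uses w <= s. *)
rewrite le_min; apply/andP; split.
  apply: (@le_trans _ _ (w * u)%R); last by rewrite mulrC ler_wpM2r.
  by rewrite ler_wpM2l// ler_piMl// min1_le1.
apply: (@le_trans _ _ (w * (r t.1.1 t.2.1 * u))%R).
  by rewrite ler_wpM2l// ler_wpM2r// ge_min lexx orbT.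
by rewrite ler_wpM2r// mulr_ge0.
Qed.

Variable f : Z -> R.
Hypothesis mf : measurable_fun setT f.

Let D2 (t : Z * Z) : R := ((f t.1 - f t.2) ^+ 2)%R.

Lemma measurable_delta_sqr : measurable_fun setT D2.
Proof.
apply: measurable_funX; apply: measurable_funB.
  exact: (measurableT_comp mf measurable_fst).
exact: (measurableT_comp mf measurable_snd).
Qed.
Let mD2 := measurable_delta_sqr.

Let D20 t : (0 <= D2 t)%R. Proof. exact: sqr_ge0. Qed.

Let mti : measurable_fun setT (fun t : Z * Z => tail_ind t.1).
Proof. exact: (measurableT_comp measurable_tail_ind measurable_fst). Qed.

Let mti' : measurable_fun setT (fun t : Z * Z => tail_ind t.2).
Proof. exact: (measurableT_comp measurable_tail_ind measurable_snd). Qed.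

Lemma half_energy_le :
  (2^-1)%:E * \int[M]_t ((kb t)%:E * (D2 t)%:E) <=
  s%:E * ((2^-1)%:E * \int[M]_t ((kt t)%:E * (D2 t)%:E)) +
  \int[M]_t ((kb t)%:E * (tail_ind t.1 * D2 t)%:E).
Proof.
have td t : (0 <= tail_ind t.1 * D2 t)%R by exact: mulr_ge0.
have td' t : (0 <= tail_ind t.2 * D2 t)%R by exact: mulr_ge0.
have mti1D : measurable_fun setT (fun t => (tail_ind t.1 * D2 t)%:E).
  by apply/measurable_EFinP; exact: measurable_funM.
have mti2D : measurable_fun setT (fun t => (tail_ind t.2 * D2 t)%:E).
  by apply/measurable_EFinP; exact: measurable_funM.
have mkbE : measurable_fun setT (fun t => (kb t)%:E) by exact/measurable_EFinP.
have mktE : measurable_fun setT (fun t => (kt t)%:E) by exact/measurable_EFinP.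
have mD2E : measurable_fun setT (fun t => (D2 t)%:E) by exact/measurable_EFinP.
(* The squared difference is invariant under exchange, so the tail at the second point costs as much
   as at the first. *)
have I1 : \int[M]_t ((kb t)%:E * (tail_ind t.2 * D2 t)%:E) =
    \int[M]_t ((kb t)%:E * (tail_ind t.1 * D2 t)%:E).
  rewrite [LHS](@ge0_integral_edge_swap _ _ _ pi q Q r mr r0 r_RN _
    (measurable_c_bar mr) (c_bar_ge0 r0) (c_bar_sym r0)
    (fun t => (tail_ind t.2 * D2 t)%:E))//.
  apply: eq_integral => t _; congr (_ * _%:E).
  by rewrite /D2 /= -opprB sqrrN.
have key : \int[M]_t ((kb t)%:E * (D2 t)%:E) <=
    s%:E * \int[M]_t ((kt t)%:E * (D2 t)%:E) +
    (\int[M]_t ((kb t)%:E * (tail_ind t.1 * D2 t)%:E) +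
     \int[M]_t ((kb t)%:E * (tail_ind t.2 * D2 t)%:E)).
  have mA : measurable_fun setT (fun t => (kt t)%:E * (D2 t)%:E).
    exact: emeasurable_funM.
  have mB : measurable_fun setT (fun t => (kb t)%:E * (tail_ind t.1 * D2 t)%:E).
    exact: emeasurable_funM.
  have mC : measurable_fun setT (fun t => (kb t)%:E * (tail_ind t.2 * D2 t)%:E).
    exact: emeasurable_funM.
  have A0 t : setT t -> 0 <= (kt t)%:E * (D2 t)%:E.
    by move=> _; rewrite mule_ge0 ?lee_fin.
  have B0 t : setT t -> 0 <= (kb t)%:E * (tail_ind t.1 * D2 t)%:E.
    by move=> _; rewrite mule_ge0 ?lee_fin.
  have C0 t : setT t -> 0 <= (kb t)%:E * (tail_ind t.2 * D2 t)%:E.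
    by move=> _; rewrite mule_ge0 ?lee_fin.
  rewrite -(ge0_integralZl M measurableT mA A0); last by rewrite lee_fin ltW.
  rewrite -(ge0_integralD M measurableT B0 mB C0 mC).
  rewrite -ge0_integralD//; first last.
  - exact: emeasurable_funD.
  - by move=> t _; rewrite adde_ge0 ?B0 ?C0.
  - exact: emeasurable_funM.
  - by move=> t _; rewrite mule_ge0 ?A0// lee_fin ltW.
  apply: ge0_le_integral => //.
  - by move=> t _; rewrite mule_ge0 ?lee_fin.
  - exact: emeasurable_funM.
  - apply: emeasurable_funD; first exact: emeasurable_funM.
    exact: emeasurable_funD.
  move=> t _; rewrite -!EFinM -!EFinD lee_fin.
  have := ler_wpM2r (D20 t) (bar_le_tilde t).
  by rewrite !mulrDl !mulrA.
have key' := key; rewrite I1 in key'.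
have A0 : 0 <= \int[M]_t ((kt t)%:E * (D2 t)%:E).
  by apply: integral_ge0 => t _; rewrite mule_ge0 ?lee_fin.
have B0 : 0 <= \int[M]_t ((kb t)%:E * (tail_ind t.1 * D2 t)%:E).
  by apply: integral_ge0 => t _; rewrite mule_ge0 ?lee_fin.
exact: half_le_of_double_tail (ltW s_gt0) A0 B0 key'.
Qed.

End tail_comparison.

(** * Null sets of pi~ and essential suprema *)

Section essential_bounds.
Context {d : measure_display} {X : measurableType d} {R : realType}.
Variables (pi : probability X R) (q : R.-pker X ~> X) (Q : R.-pker X ~> R).
Hypothesis Q_lt0 : forall x, Q x [set w : R | (w < 0)%R] = 0.
Hypothesis Q_mean : forall x, \int[Q x]_w w%:E = 1.

Let Z := (X * R)%type.
Let hat := hatk pi Q tt.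
Let M := movek pi q Q tt.

Let mwp : measurable_fun setT (fun z : Z => (wp z.2)%:E).
Proof. by apply/measurable_EFinP; exact: measurable_wp2. Qed.

Lemma integral_hatk_wp : \int[hat]_z (wp z.2)%:E = 1.
Proof.
rewrite /hat /hatk ge0_integral_kjoint;
  [|by move=> z; rewrite lee_fin wp_ge0|exact: mwp].
rewrite (eq_integral (cst 1)); last by move=> x _; exact: wp_mean.
by rewrite integral_cst// mul1e; exact: (probability_setT pi).
Qed.

Lemma pit_setE (N : set Z) : measurable N ->
  pit_set pi Q N = \int[hat]_z ((wp z.2)%:E * (\1_N z)%:E).
Proof.
move=> mN; by apply: ge0_pit_int => //; exact/measurable_EFinP.
Qed.

(** pi~ has density w with respect to [hatk], so its null sets are those that are [hatk]-null within
    w > 0. *)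
Lemma pit_set_eq0 (N : set Z) : measurable N ->
  pit_set pi Q N = 0 <-> {ae hat, forall z, (0 < wp z.2)%R -> ~ N z}.
Proof.
move=> mN; rewrite pit_setE//.
have mF : measurable_fun setT (fun z => (wp z.2)%:E * (\1_N z)%:E).
  by apply: emeasurable_funM => //; exact/measurable_EFinP.
rewrite (eq_integral (fun z => `|(wp z.2)%:E * (\1_N z)%:E|)); last first.
  by move=> z _; rewrite gee0_abs// mule_ge0 ?lee_fin ?wp_ge0.
rewrite (ae_eq_integral_abs _ measurableT mF); split.
- apply: filterS => z /= /(_ Logic.I) + w0 Nz.
  by rewrite indicE mem_set// mule1 => -[] /eqP; rewrite gt_eqF.
- apply: filterS => z /= wN _; have [Nz|Nz] := pselect (N z); last first.
    by rewrite indicE memNset// mule0.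
  have := wp_ge0 z.2; rewrite le_eqVlt => /predU1P[<-|w0]; first by rewrite mul0e.
  by have := wN w0 Nz.
Qed.

(** pi~ has mass 1, so a property that holds pi~-almost everywhere holds somewhere. *)
Lemma hatk_ae_ex (P : Z -> Prop) :
  {ae hat, forall z, (0 < wp z.2)%R -> P z} -> exists z, P z.
Proof.
move=> aeP; apply/not_existsP => nP.
have : \int[hat]_z (wp z.2)%:E = 0.
  rewrite -(integral0 hat setT); apply: ae_eq_integral => //.
  apply: filterS aeP => z zP _; have := wp_ge0 z.2.
  rewrite le_eqVlt => /predU1P[<-//|w0].
  by have := nP z (zP w0).
by rewrite integral_hatk_wp => /eqP; rewrite onee_eq0.
Qed.

Lemma measurable_gt_set (g : Z -> R) (B : \bar R) : measurable_fun setT g ->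
  measurable [set z | B < (g z)%:E].
Proof.
move=> mg; have mgE : measurable_fun setT (fun z => (g z)%:E).
  exact/measurable_EFinP.
by rewrite -[X in measurable X]setTI; exact: emeasurable_fun_o_infty.
Qed.

(** The infimum of the essential upper bounds is finite, and it is attained because countably many
    null sets, one for each 1 / (n + 1), have a null union. *)
Lemma pit_esssupP (g : Z -> R) (b : R) : measurable_fun setT g ->
  {ae hat, forall z, (0 < wp z.2)%R -> (`|g z| <= b)%R} ->
  exists2 sigma : R, pit_esssup pi Q g = sigma%:E &
    {ae hat, forall z, (0 < wp z.2)%R -> (g z <= sigma)%R}.
Proof.
move=> mg gb.
pose S := [set B : \bar R | pit_set pi Q [set z | B < (g z)%:E] = 0].
have SP B : S B -> {ae hat, forall z, (0 < wp z.2)%R -> (g z)%:E <= B}.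
  move=> /(pit_set_eq0 (measurable_gt_set B mg)).1.
  by apply: filterS => z /= + w0 => /(_ w0) /negP; rewrite -leNgt.
have Sb : S b%:E.
  apply/(pit_set_eq0 (measurable_gt_set b%:E mg)).2.
  apply: filterS gb => z /= + w0 => /(_ w0) gz.
  by apply/negP; rewrite -leNgt lee_fin (le_trans (ler_norm _) gz).
(* Some point satisfies both -b <= g and g <= B. *)
have lbS B : S B -> (- b)%:E <= B.
  move=> /SP SB; have [z [gz1 gz2]] : exists z, (`|g z| <= b)%R /\ (g z)%:E <= B.
    apply: hatk_ae_ex; apply: filterS2 gb SB => z g1 g2 w0.
    by split; [exact: g1|exact: g2].
  by apply: le_trans gz2; rewrite lee_fin lerNl (le_trans _ gz1)// -normrN ler_norm.
have fin_inf : ereal_inf S \is a fin_num.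
  rewrite fin_numElt; apply/andP; split.
    apply: (@lt_le_trans _ _ (- b)%:E); first by rewrite ltNyr.
    exact: le_ereal_inf_tmp.
  by apply: (@le_lt_trans _ _ b%:E); [exact: ereal_inf_lbound|rewrite ltry].
exists (fine (ereal_inf S)); first by rewrite fineK.
have Sn n : {ae hat, forall z, (0 < wp z.2)%R ->
    (g z <= fine (ereal_inf S) + n.+1%:R^-1)%R}.
  have e0 : (0 < n.+1%:R^-1 :> R)%R by rewrite invr_gt0.
  have [B SB Blt] := lb_ereal_inf_adherent e0 fin_inf.
  apply: filterS (SP _ SB) => z gz w0.
  rewrite -lee_fin EFinD fineK//.
  exact: le_trans (gz w0) (ltW Blt).
apply: filterS (ae_foralln Sn) => z gz w0.
apply/ler_addgt0Pr => e e0.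
have [n ne] : exists n, (n.+1%:R^-1 < e)%R.
  exists (Num.truncn e^-1); rewrite invf_plt ?posrE//.
  by rewrite truncnS_gt.
by apply: (le_trans (gz n w0)); rewrite lerD2l ltW.
Qed.

End essential_bounds.

Lemma midpoint_powR {R : realType} (p x y : R) : (1 <= p)%R ->
  (0 <= x)%R -> (0 <= y)%R ->
  ((2^-1 * x + 2^-1 * y) `^ p <= 2^-1 * x `^ p + 2^-1 * y `^ p)%R.
Proof.
move=> p1 x0 y0.
have h0 : (0 <= 2^-1 :> R)%R by rewrite invr_ge0.
have h1 : (2^-1 <= 1 :> R)%R by rewrite invf_le1 ?ler1n.
have := @convex_powR R p p1 (Itv01 h0 h1) x y.
rewrite !inE /= !in_itv /= !andbT => /(_ x0 y0).
rewrite convRE [X in (X `^ _)%R]convRE /= (_ : unstable.onem 2^-1 = 2^-1 :> R)%R//.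
by rewrite /unstable.onem; field.
Qed.

Lemma sqrB_powR_le {R : realType} (p a b : R) : (1 <= p)%R ->
  (((a - b) ^+ 2) `^ p <=
   4 `^ p * (2^-1 * `|a| `^ (2 * p) + 2^-1 * `|b| `^ (2 * p)))%R.
Proof.
move=> p1; have p0 : (0 <= p)%R by apply: le_trans p1.
have sqrE (x : R) : (`|x| `^ (2 * p) = (x ^+ 2) `^ p)%R.
  by rewrite powRrM powR_mulrn ?normr_ge0// real_normK ?num_real.
rewrite !sqrE.
have m0 : (0 <= 2^-1 * a ^+ 2 + 2^-1 * b ^+ 2)%R.
  by rewrite addr_ge0// mulr_ge0 ?invr_ge0 ?sqr_ge0.
apply: (@le_trans _ _ ((4 * (2^-1 * a ^+ 2 + 2^-1 * b ^+ 2)) `^ p)%R).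
  apply: ge0_ler_powR => //; rewrite ?nnegrE ?sqr_ge0 ?mulr_ge0//.
  by have := sqr_ge0 (a + b)%R; lra.
by rewrite powRM// ler_wpM2l ?powR_ge0// midpoint_powR ?sqr_ge0.
Qed.

(** * The tail energy, by oscillation and by Hoelder's inequality *)

Section tail_energy.
Context {d : measure_display} {X : measurableType d} {R : realType}.
Variables (pi : probability X R) (q : R.-pker X ~> X) (Q : R.-pker X ~> R).
Hypothesis Q_lt0 : forall x, Q x [set w : R | (w < 0)%R] = 0.
Hypothesis Q_mean : forall x, \int[Q x]_w w%:E = 1.

Let Z := (X * R)%type.
Let hat := hatk pi Q tt.
Let M := movek pi q Q tt.

Variable r : X -> X -> R.
Hypothesis mr : measurable_fun setT (fun xy : X * X => r xy.1 xy.2).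
Hypothesis r0 : forall x y, (0 <= r x y)%R.
Hypothesis r_RN : forall C : set (X * X), measurable C ->
     \int[pi]_x \int[q x]_y ((r x y)%:E * (\1_C (x, y))%:E)
     = \int[pi]_x \int[q x]_y (\1_C (y, x))%:E.

Variable s : R.

Let kb := edge_weight (c_bar r).

Let kb0 t : (0 <= kb t)%R.
Proof. by apply: edge_weight_ge0 => t'; exact: c_bar_ge0. Qed.

Let mkb : measurable_fun setT kb.
Proof. by apply: measurable_edge_weight; exact: measurable_c_bar. Qed.

Let mwp : measurable_fun setT (fun z : Z => (wp z.2)%:E).
Proof. by apply/measurable_EFinP; exact: measurable_wp2. Qed.

Let mkbE : measurable_fun setT (fun t => (kb t)%:E).
Proof. exact/measurable_EFinP. Qed.

Let kb_fst (g : Z -> \bar R) : measurable_fun setT g -> (forall z, 0 <= g z) ->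
  \int[M]_t ((kb t)%:E * g t.1) <= \int[hat]_z ((wp z.2)%:E * g z).
Proof.
by move=> mg g0; apply: ge0_integral_edge_fst => //;
  [exact: measurable_c_bar|exact: c_bar_ge0|exact: c_bar_le1].
Qed.

Let kb_snd (g : Z -> \bar R) : measurable_fun setT g -> (forall z, 0 <= g z) ->
  \int[M]_t ((kb t)%:E * g t.2) <= \int[hat]_z ((wp z.2)%:E * g z).
Proof.
by move=> mg g0; apply: (@ge0_integral_edge_snd _ _ _ _ _ _ r) => //;
  [exact: measurable_c_bar|exact: c_bar_ge0|exact: c_bar_le1|exact: c_bar_sym].
Qed.

Lemma bar_weight_gt0 t : (0 < kb t)%R -> (0 < wp t.1.2)%R /\ (0 < wp t.2.2)%R.
Proof.
rewrite /kb /edge_weight /c_bar => k_gt0.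
split; rewrite lt_neqAle wp_ge0 andbT; apply/negP => /eqP w0;
  by move: k_gt0; rewrite -w0 ?mul0r ?mulr0 ltxx.
Qed.

(** Both marginals of kb dM are dominated by pi~, so a pi~-null set is avoided by both ends of
    almost every pair of positive weight. *)
Lemma movek_ae (P : Z -> Prop) :
  {ae hat, forall z, (0 < wp z.2)%R -> P z} ->
  {ae M, forall t, (0 < kb t)%R -> P t.1 /\ P t.2}.
Proof.
move=> [N [mN N0 PN]].
have mN1 : measurable_fun setT (fun z : Z => (\1_N z)%:E : \bar R).
  exact/measurable_EFinP.
have N1 z : 0 <= (\1_N z)%:E :> \bar R by rewrite lee_fin.
have I0 : \int[hat]_z ((wp z.2)%:E * (\1_N z)%:E) = 0.
  rewrite -(integral0 hat setT); apply: ae_eq_integral => //.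
    exact: emeasurable_funM.
  exists N; split => // z /= /not_implyP[_]; apply: contra_notP => Nz.
  by rewrite indicE memNset// mule0.
have null (F : Z * Z -> \bar R) : measurable_fun setT F -> (forall t, 0 <= F t) ->
    \int[M]_t ((kb t)%:E * F t) <= \int[hat]_z ((wp z.2)%:E * (\1_N z)%:E) ->
    {ae M, forall t, (kb t)%:E * F t = 0}.
  move=> mF F0; rewrite I0 => F_le0.
  have mkF : measurable_fun setT (fun t => (kb t)%:E * F t).
    exact: emeasurable_funM.
  have kF0 t : 0 <= (kb t)%:E * F t by rewrite mule_ge0 ?lee_fin.
  have : \int[M]_t `|(kb t)%:E * F t| = 0.
    apply/eqP; rewrite eq_le integral_ge0// andbT; apply: le_trans F_le0.
    by apply: ge0_le_integral => //; [exact: measurableT_comp|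
      move=> t _; rewrite gee0_abs].
  by move/(ae_eq_integral_abs _ measurableT mkF); apply: filterS => t /(_ Logic.I).
have A1 := null (fun t => (\1_N t.1)%:E) (measurableT_comp mN1 measurable_fst)
  (fun t => N1 t.1) (kb_fst mN1 N1).
have A2 := null (fun t => (\1_N t.2)%:E) (measurableT_comp mN1 measurable_snd)
  (fun t => N1 t.2) (kb_snd mN1 N1).
have notN z t : (0 < kb t)%R -> (kb t)%:E * (\1_N z)%:E = 0 -> ~ N z.
  move=> k_gt0 + Nz; rewrite indicE mem_set// mule1 => -[] /eqP.
  by rewrite gt_eqF.
apply: filterS2 A1 A2 => t t1 t2 k_gt0.
have [w1 w2] := bar_weight_gt0 k_gt0.
split; apply: contrapT => nP.
  by apply: (notN t.1 t k_gt0 t1); apply: PN => /= /(_ w1).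
by apply: (notN t.2 t k_gt0 t2); apply: PN => /= /(_ w2).
Qed.

Let mtE : measurable_fun setT (fun z : Z => (tail_ind s z)%:E).
Proof. by apply/measurable_EFinP; exact: measurable_tail_ind. Qed.

Let t0 (z : Z) : 0 <= (tail_ind s z)%:E.
Proof. by rewrite lee_fin tail_ind_ge0. Qed.

Lemma tail_massE :
  (tail_mass pi Q s)%:E = \int[hat]_z ((wp z.2)%:E * (tail_ind s z)%:E).
Proof.
have E : \int[pi]_x \int[Q x]_w (w * \1_[set v : R | (s <= v)%R] w)%:E =
    \int[hat]_z ((wp z.2)%:E * (tail_ind s z)%:E).
  rewrite -(ge0_pit_int pi Q_lt0 mtE t0) /pit_int.
  by apply: eq_integral => x _; apply: eq_integral => w _; rewrite EFinM.
(* [fine] loses nothing, since the tail is bounded by the total mass 1 of pi~. *)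
rewrite /tail_mass E fineK// ge0_fin_numE; last first.
  by apply: integral_ge0 => z _; rewrite mule_ge0 ?lee_fin ?wp_ge0.
apply: (@le_lt_trans _ _ 1); last by rewrite ltry.
rewrite -(integral_hatk_wp pi Q_lt0 Q_mean); apply: ge0_le_integral => //.
- by move=> z _; rewrite mule_ge0 ?lee_fin ?wp_ge0.
- exact: emeasurable_funM.
move=> z _; rewrite -EFinM lee_fin ler_piMr ?wp_ge0//.
by rewrite tail_indE; case: (s <= z.2)%R.
Qed.

Lemma tail_mass_ge0 : (0 <= tail_mass pi Q s)%R.
Proof.
rewrite -lee_fin tail_massE; apply: integral_ge0 => z _.
by rewrite mule_ge0 ?lee_fin ?wp_ge0.
Qed.

Lemma bar_tail_le :
  \int[M]_t ((kb t)%:E * (tail_ind s t.1)%:E) <= (tail_mass pi Q s)%:E.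
Proof. by rewrite tail_massE; exact: (kb_fst mtE t0). Qed.

Variable f : Z -> R.
Hypothesis mf : measurable_fun setT f.

Let D2 (t : Z * Z) : R := ((f t.1 - f t.2) ^+ 2)%R.

Let mD2 : measurable_fun setT D2.
Proof. exact: measurable_delta_sqr. Qed.

Let mti : measurable_fun setT (fun t : Z * Z => tail_ind s t.1).
Proof. exact: (measurableT_comp (measurable_tail_ind s) measurable_fst). Qed.

Let td t : (0 <= tail_ind s t.1 * D2 t)%R.
Proof. by rewrite mulr_ge0 ?tail_ind_ge0 ?sqr_ge0. Qed.

Lemma bar_tail_energy_osc (b : R) :
  {ae hat, forall z, (0 < wp z.2)%R -> (`|f z| <= b)%R} ->
  \int[M]_t ((kb t)%:E * (tail_ind s t.1 * D2 t)%:E) <=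
  (pit_osc pi Q f ^+ 2 * tail_mass pi Q s)%:E.
Proof.
move=> fb.
have [s1 s1E fs1] := pit_esssupP Q_lt0 Q_mean mf fb.
have mNf : measurable_fun setT (fun z => - f z)%R.
  exact: (measurableT_comp (@oppr_measurable R setT) mf).
have fNb : {ae hat, forall z, (0 < wp z.2)%R -> (`|- f z| <= b)%R}.
  by apply: filterS fb => z + w0 => /(_ w0); rewrite normrN.
(* The essential infimum of [f] is [- s2], so the oscillation is [s1 + s2]. *)
have [s2 s2E fs2] := pit_esssupP Q_lt0 Q_mean mNf fNb.
have oscE : pit_osc pi Q f = (s1 + s2)%R.
  rewrite /pit_osc /pit_essinf s1E.
  have -> : pit_esssup pi Q (fun z => (- f z)%R) = s2%:E by [].
  by rewrite oppeK.
have := movek_ae (P := fun z => (f z <= s1)%R /\ (- f z <= s2)%R).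
have fs12 : {ae hat, forall z, (0 < wp z.2)%R -> (f z <= s1)%R /\ (- f z <= s2)%R}.
  by apply: filterS2 fs1 fs2 => z f1 f2 w0; split; [exact: f1|exact: f2].
move=> /(_ fs12) Mae.
apply: (@le_trans _ _ (\int[M]_t ((pit_osc pi Q f ^+ 2)%:E *
    ((kb t)%:E * (tail_ind s t.1)%:E)))).
  apply: ae_ge0_le_integral => //.
  - by move=> t _; rewrite mule_ge0 ?lee_fin.
  - apply: emeasurable_funM => //; apply/measurable_EFinP.
    exact: measurable_funM.
  - by move=> t _; rewrite !mule_ge0 ?lee_fin ?sqr_ge0.
  - apply: emeasurable_funM => //; apply: emeasurable_funM => //.
    exact/measurable_EFinP.
  apply: filterS Mae => t tk _; have := kb0 t.
  rewrite le_eqVlt => /predU1P[<-|k_gt0]; first by rewrite !mul0e mule0.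
  have [[a1 a2] [b1 b2]] := tk k_gt0.
  rewrite -!EFinM lee_fin [leRHS]mulrCA ler_wpM2l// [leRHS]mulrC.
  rewrite ler_wpM2l ?tail_ind_ge0//.
  have d_le : (`|f t.1 - f t.2| <= s1 + s2)%R.
    by rewrite ler_norml; apply/andP; split; lra.
  rewrite /D2 oscE -real_normK ?num_real// lerXn2r ?nnegrE//.
  exact: le_trans d_le.
rewrite ge0_integralZl//; first last.
- by rewrite lee_fin sqr_ge0.
- by move=> t _; rewrite mule_ge0 ?lee_fin.
- by apply: emeasurable_funM => //; exact/measurable_EFinP.
rewrite [leRHS]EFinM; apply: lee_wpmul2l; last exact: bar_tail_le.
by rewrite lee_fin sqr_ge0.
Qed.

Lemma bar_tail_energy_hoelder (p qq : R) :
  (1 < p)%R -> (0 < qq)%R -> (p^-1 + qq^-1 = 1)%R ->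
  pit_int pi Q (fun z => (`|f z| `^ (2 * p))%:E) < +oo ->
  \int[M]_t ((kb t)%:E * (tail_ind s t.1 * D2 t)%:E) <=
  (4 * fine (pit_int pi Q (fun z => (`|f z| `^ (2 * p))%:E)) `^ p^-1
   * tail_mass pi Q s `^ qq^-1)%:E.
Proof.
move=> p1 q0 pq Noo.
have p0 : (0 < p)%R by apply: lt_trans p1.
pose W z := (`|f z| `^ (2 * p))%R.
have Wr z : (0 <= W z)%R by exact: powR_ge0.
have W0 z : 0 <= (W z)%:E by rewrite lee_fin powR_ge0.
have mW : measurable_fun setT (fun z => (W z)%:E).
  apply/measurable_EFinP.
  exact: (measurableT_comp (@measurable_powR R _)
    (measurableT_comp (@normr_measurable R setT) mf)).
have NE := ge0_pit_int pi Q_lt0 mW W0.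
set N := fine _.
have NN : (N%:E = \int[hat]_z ((wp z.2)%:E * (W z)%:E)).
  rewrite -NE /N fineK// ge0_fin_numE// NE; apply: integral_ge0 => z _.
  by rewrite mule_ge0 ?lee_fin ?wp_ge0.
have N0 : (0 <= N)%R.
  rewrite -lee_fin NN; apply: integral_ge0 => z _.
  by rewrite mule_ge0 ?lee_fin ?wp_ge0.
pose a t := (kb t * tail_ind s t.1)%R.
have a0 t : (0 <= a t)%R by rewrite mulr_ge0 ?tail_ind_ge0.
have ma : measurable_fun setT a by exact: measurable_funM.
(* The weight is split between the two factors: [F] to the power [qq] integrates to at most the tail
   mass, and [G] to the power [p] is the weight times [D2] to the power [p]. *)
pose F t := (a t `^ qq^-1)%R.
pose G t := (a t `^ p^-1 * D2 t)%R.
have mF : measurable_fun setT F.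
  exact: (measurableT_comp (@measurable_powR R _) ma).
have mG : measurable_fun setT G.
  apply: measurable_funM => //.
  exact: (measurableT_comp (@measurable_powR R _) ma).
have D20 t : (0 <= D2 t)%R by exact: sqr_ge0.
have FG t : (F t * G t = a t * D2 t)%R.
  by rewrite /F /G mulrA -powRD addrC pq ?oner_eq0// powRr1.
have := @hoelder _ _ _ M F G qq p mF mG q0 p0.
rewrite addrC pq => /(_ erefl).
have -> : Lnorm M 1 (EFin \o (F \* G)%R) =
    \int[M]_t ((kb t)%:E * (tail_ind s t.1 * D2 t)%:E).
  rewrite Lnorm1; apply: eq_integral => t _ /=.
  rewrite FG ger0_norm ?(mulr_ge0 (a0 t) (D20 t))// -EFinM.
  by congr EFin; rewrite /a -mulrA.
move=> /le_trans; apply.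
rewrite mulrC EFinM; apply: lee_pmul.
- exact: Lnorm_ge0.
- exact: Lnorm_ge0.
- rewrite unlock -poweR_EFin; apply: gt0_ler_poweR.
  + by rewrite invr_ge0 ltW.
  + by rewrite in_itv /= leey andbT integral_ge0// => t _; exact: poweR_ge0.
  + by rewrite in_itv /= leey andbT lee_fin tail_mass_ge0.
  apply: le_trans bar_tail_le; rewrite le_eqVlt; apply/orP; left; apply/eqP.
  apply: eq_integral => t _ /=; rewrite ger0_norm ?powR_ge0//.
  by rewrite -powRrM mulVf ?gt_eqF// powRr1// EFinM.
(* The constant goes under the p-th root, which leaves a bound on the integral of [G] to the power
   [p]. *)
have -> : (4 * N `^ p^-1 = (4 `^ p * N) `^ p^-1)%R.
  by rewrite powRM ?powR_ge0// -powRrM divff ?gt_eqF// powRr1.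
rewrite unlock -poweR_EFin; apply: gt0_ler_poweR.
- by rewrite invr_ge0 ltW.
- by rewrite in_itv /= leey andbT integral_ge0// => t _; exact: poweR_ge0.
- by rewrite in_itv /= leey andbT lee_fin mulr_ge0 ?powR_ge0.
have W1 : \int[M]_t ((kb t)%:E * (W t.1)%:E) <= N%:E.
  by rewrite NN; exact: (kb_fst mW W0).
have W2 : \int[M]_t ((kb t)%:E * (W t.2)%:E) <= N%:E.
  by rewrite NN; exact: (kb_snd mW W0).
have mW1 : measurable_fun setT (fun t : Z * Z => (kb t)%:E * (W t.1)%:E).
  by apply: emeasurable_funM => //; exact: (measurableT_comp mW measurable_fst).
have mW2 : measurable_fun setT (fun t : Z * Z => (kb t)%:E * (W t.2)%:E).
  by apply: emeasurable_funM => //; exact: (measurableT_comp mW measurable_snd).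
have kW0 (z : Z) (u : Z * Z) : 0 <= (kb u)%:E * (W z)%:E.
  by rewrite mule_ge0 ?lee_fin.
have c0 : 0 <= (4 `^ p * 2^-1)%:E :> \bar R.
  by rewrite lee_fin mulr_ge0 ?powR_ge0 ?invr_ge0.
apply: (@le_trans _ _ (\int[M]_t ((4 `^ p * 2^-1)%:E *
    ((kb t)%:E * (W t.1)%:E + (kb t)%:E * (W t.2)%:E)))).
  apply: ge0_le_integral => //.
  - by move=> t _; exact: poweR_ge0.
  - apply/measurable_EFinP; apply: (measurableT_comp (@measurable_powR R _)).
    exact: (measurableT_comp (@normr_measurable R setT) mG).
  - by apply: emeasurable_funM => //; exact: emeasurable_funD.
  move=> t _ /=; rewrite -?EFinM -?EFinD -?EFinM lee_fin.
  rewrite ger0_norm; last by rewrite mulr_ge0 ?powR_ge0.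
  rewrite /G powRM ?powR_ge0// -powRrM mulVf ?gt_eqF// powRr1//.
  apply: (@le_trans _ _ (kb t * (D2 t) `^ p)%R).
    rewrite ler_wpM2r ?powR_ge0// /a ler_piMr// tail_indE.
    by case: (s <= t.1.2)%R.
  have := ler_wpM2l (kb0 t) (sqrB_powR_le (f t.1) (f t.2) (ltW p1)).
  move=> /le_trans; apply; rewrite -/(W t.1) -/(W t.2) le_eqVlt.
  by apply/orP; left; apply/eqP; ring.
rewrite ge0_integralZl//; first last.
- by move=> t _; rewrite adde_ge0 ?kW0.
- exact: emeasurable_funD.
rewrite ge0_integralD//.
apply: (le_trans (lee_wpmul2l c0 (leeD W1 W2))).
by rewrite -EFinD -EFinM lee_fin le_eqVlt; apply/orP; left; apply/eqP; field.
Qed.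

End tail_energy.

(** * Square integrability of the test function *)

Section square_integrability.
Context {d : measure_display} {X : measurableType d} {R : realType}.
Variables (pi : probability X R) (Q : R.-pker X ~> R).
Hypothesis Q_lt0 : forall x, Q x [set w : R | (w < 0)%R] = 0.
Hypothesis Q_mean : forall x, \int[Q x]_w w%:E = 1.
Variable f : X * R -> R.
Hypothesis mf : measurable_fun setT f.

Let hat := hatk pi Q tt.

Let mwp : measurable_fun setT (fun z : X * R => (wp z.2)%:E).
Proof. by apply/measurable_EFinP; exact: measurable_wp2. Qed.

Let mf2 : measurable_fun setT (fun z => (f z ^+ 2)%:E).
Proof. by apply/measurable_EFinP; exact: measurable_funX. Qed.

Let mabs : measurable_fun setT (fun z => `|f z|)%R.
Proof. exact: (measurableT_comp (@normr_measurable R setT) mf). Qed.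

Lemma pit_set_abs_gt (b : R) : pit_set pi Q [set z | b < `|f z|]%R = 0 ->
  {ae hat, forall z, (0 < wp z.2)%R -> (`|f z| <= b)%R}.
Proof.
have mN : measurable [set z | b < `|f z|]%R.
  rewrite (_ : mkset _ = [set z | b%:E < (`|f z|)%:E]).
    exact: measurable_gt_set.
  by apply/seteqP; split => z /=; rewrite lte_fin.
move=> /(pit_set_eq0 _ Q_lt0 mN).1.
by apply: filterS => z /= + w0 => /(_ w0) /negP; rewrite -leNgt.
Qed.

Lemma sqr_integrable_bounded (b : R) :
  {ae hat, forall z, (0 < wp z.2)%R -> (`|f z| <= b)%R} ->
  \int[hat]_z ((wp z.2)%:E * (f z ^+ 2)%:E) < +oo.
Proof.
move=> fb; apply: (@le_lt_trans _ _ (\int[hat]_z ((b ^+ 2)%:E * (wp z.2)%:E))).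
  apply: ae_ge0_le_integral => //.
  - by move=> z _; rewrite mule_ge0 ?lee_fin ?wp_ge0 ?sqr_ge0.
  - exact: emeasurable_funM.
  - by move=> z _; rewrite mule_ge0 ?lee_fin ?wp_ge0 ?sqr_ge0.
  - exact: emeasurable_funM.
  apply: filterS fb => z fz _; have := wp_ge0 z.2.
  rewrite le_eqVlt => /predU1P[<-|w0]; first by rewrite mul0e mule0.
  rewrite muleC lee_pmul2r ?lte_fin// lee_fin -real_normK ?num_real//.
  by rewrite lerXn2r ?nnegrE ?(le_trans _ (fz w0))// fz.
rewrite ge0_integralZl//.
- by rewrite (integral_hatk_wp pi Q_lt0 Q_mean) mule1 ltry.
- by move=> z _; rewrite lee_fin wp_ge0.
- by rewrite lee_fin sqr_ge0.
Qed.

(** pi~ is a probability and f^2 <= 1 + |f|^(2p), by cases on |f| <= 1. *)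
Lemma sqr_integrable_powR (p : R) : (1 < p)%R ->
  pit_int pi Q (fun z => (`|f z| `^ (2 * p))%:E) < +oo ->
  \int[hat]_z ((wp z.2)%:E * (f z ^+ 2)%:E) < +oo.
Proof.
move=> p1.
have mW : measurable_fun setT (fun z => (`|f z| `^ (2 * p))%:E).
  by apply/measurable_EFinP; exact: (measurableT_comp (@measurable_powR R _) mabs).
have W0 z : 0 <= (`|f z| `^ (2 * p))%:E by rewrite lee_fin powR_ge0.
rewrite (ge0_pit_int _ Q_lt0 mW W0) => Noo.
apply: (@le_lt_trans _ _ (\int[hat]_z ((wp z.2)%:E +
    (wp z.2)%:E * (`|f z| `^ (2 * p))%:E))).
  apply: ge0_le_integral => //.
  - by move=> z _; rewrite mule_ge0 ?lee_fin ?wp_ge0 ?sqr_ge0.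
  - exact: emeasurable_funM.
  - by apply: emeasurable_funD => //; exact: emeasurable_funM.
  move=> z _; rewrite -!EFinM -EFinD lee_fin.
  rewrite -{2}[wp z.2]mulr1 -mulrDr ler_wpM2l ?wp_ge0//.
  rewrite -real_normK ?num_real//; have [f1|f1] := leP `|f z|%R 1%R.
    apply: (@le_trans _ _ 1%R); last by rewrite lerDl powR_ge0.
    by rewrite expr_le1.
  rewrite -powR_mulrn ?normr_ge0//.
  apply: (@le_trans _ _ (`|f z| `^ (2 * p))%R); last by rewrite lerDr.
  by apply: ler_powR; [exact: ltW|lra].
rewrite ge0_integralD//; first last.
- exact: emeasurable_funM.
- by move=> z _; rewrite mule_ge0 ?W0// lee_fin wp_ge0.
- by move=> z _; rewrite lee_fin wp_ge0.
by rewrite (integral_hatk_wp pi Q_lt0 Q_mean) lte_add_pinfty// ltry.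
Qed.

End square_integrability.

Theorem theorem43 (d : measure_display) (X : measurableType d) (R : realType)
  (pi : probability X R) (q : R.-pker X ~> X) (Q : R.-pker X ~> R)
  (r : X -> X -> R)
  (HQpos : forall x, Q x [set w : R | (w < 0)%R] = 0)
  (HQmean : forall x, \int[Q x]_w w%:E = 1)
  (Hr_meas : measurable_fun setT (fun xy : X * X => r xy.1 xy.2))
  (Hr_ge0 : forall x y, (0 <= r x y)%R)
  (Hr_RN : forall C : set (X * X), measurable C ->
     \int[pi]_x \int[q x]_y ((r x y)%:E * (\1_C (x, y))%:E)
     = \int[pi]_x \int[q x]_y (\1_C (y, x))%:E)
  (p : \bar R) (qq : R) (Hp : 1%:E < p) (Hqq : (1 <= qq)%R)
  (Hconj : conj_exp p qq)
  (s : R) (Hs : (0 < s)%R)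
  (f : X * R -> R) (Hf : in_L0_2p pi Q p f) :
  dirichlet pi Q (Pbar_op q Q r f) f
  <= s%:E * dirichlet pi Q (Ptilde_op q Q r f) f
     + (Phi pi Q p f * tail_mass pi Q s `^ (qq^-1))%:E.
Proof.
(* Common to finite and infinite [p]: only square integrability and a bound on the tail energy
   remain to be supplied. *)
have compare (F2 : \int[hatk pi Q tt]_z ((wp z.2)%:E * (f z ^+ 2)%:E) < +oo)
    (mf : measurable_fun setT f) (B : \bar R) :
    \int[movek pi q Q tt]_t ((edge_weight (c_bar r) t)%:E *
      (tail_ind s t.1 * (f t.1 - f t.2) ^+ 2)%:E) <= B ->
    dirichlet pi Q (Pbar_op q Q r f) f <=
    s%:E * dirichlet pi Q (Ptilde_op q Q r f) f + B.
  move=> tailB.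
  rewrite (dirichlet_bar HQpos HQmean Hr_meas Hr_ge0 Hr_RN mf F2).
  rewrite (dirichlet_tilde HQpos Hr_meas Hr_ge0 Hr_RN mf F2).
  have := half_energy_le Q Hr_meas Hr_ge0 Hr_RN Hs mf.
  by move=> /le_trans; apply; rewrite leeD2l.
case: Hf => mf _; case: p Hp Hconj => [p'| |] //=.
- rewrite lte_fin => p1 pq Noo.
  have q0 : (0 < qq)%R by apply: lt_le_trans Hqq.
  apply: compare => //; first exact: (sqr_integrable_powR HQpos HQmean mf p1).
  exact: bar_tail_energy_hoelder.
- move=> _ -> [b fb].
  have {}fb := pit_set_abs_gt HQpos mf fb.
  apply: compare => //; first exact: (sqr_integrable_bounded HQpos HQmean mf fb).
  rewrite invr1 powRr1; last exact: tail_mass_ge0.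
  exact: bar_tail_energy_osc fb.
Qed.
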